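(* Let $m\ge 2$, $1\le k\le m$, $t_1,\dots,t_k\ge 1$, let $G=L_{m,t_1,\ldots,t_k}$ be a $k$-handle lollipop graph, and let $t=\sum_{i=1}^k t_i$. Then for $i\ge 1$ we have $$\beta_{i,i+j}(S/J_G)=\begin{cases}(i-j+1)\binom{m}{i-j+2}\binom{t}{j-1} & \text{if } 1\leq j\leq i-1,\\[4pt] \binom{t}{i-1}\binom{m}{2}+\binom{t}{i} & \text{if } j=i.\end{cases}$$ Moreover, $\mathrm{pd}(S/J_G)=m+t-1$ and $\mathrm{reg}(S/J_G)=t+1$.
   Context: Let $K$ be a field. For a finite simple graph $G$ on $n$ vertices labelled by $[n]$, with edge set $E(G)$, let $S=K[x_1,\ldots,x_n,y_1,\ldots,y_n]$ (standard grading); the binomial edge ideal $J_G\subset S$ is generated by the binomials $x_iy_j-x_jy_i$ with $i<j$ and $\{i,j\}\in E(G)$. Here $\beta_{i,j}$, $\mathrm{pd}$ and $\mathrm{reg}$ denote graded Betti numbers, projective dimension and Castelnuovo–Mumford regularity over $S$. For $m\ge2$ and $1\le k\le m$, the $k$-handle lollipop graph $L_{m,t_1,\ldots,t_k}$ is the graph obtained from the complete graph $K_m$ and $k$ pairwise disjoint paths $P_{t_1},\dots,P_{t_k}$, where $P_{s}$ denotes the path on $s$ vertices, by choosing $k$ distinct vertices $v_1,\dots,v_k$ of $K_m$ and joining, for each $i$, a leaf (end vertex) of $P_{t_i}$ to $v_i$ by an edge (if $t_i=1$, the leaf is the single vertex of $P_{1}$). Thus the graph has $m+t_1+\cdots+t_k$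 vertices. Binomial coefficients $\binom{a}{b}$ with $b>a\ge0$ are zero. *)

(* Defs.v *)
From HB Require Import structures.
From mathcomp Require Import all_boot all_order all_algebra.
From mathcomp Require Import mpoly.
From Stdlib Require Import ClassicalEpsilon.

Set Implicit Arguments.
Unset Strict Implicit.
Unset Printing Implicit Defensive.

Import GRing.Theory.
Local Open Scope ring_scope.

(* F_i is the direct sum of the S(- gdeg F i a), a < rank F i, seen as row
   vectors; F_(i+1) -> F_i is right multiplication by [gdiff F i].  The
   augmentation F_0 -> S/I is given by a lift F_0 -> S, namely [gaug F].
   Since S/I lives in nonnegative degrees, so do the generators of a minimal
   resolution, and degrees in nat lose nothing. *)
Record gcomplex (K : fieldType) (N : nat) := GComplex {
  rank : nat -> nat;
  gdeg : forall i : nat, 'I_(rank i) -> nat;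
  gdiff : forall i : nat, 'M[{mpoly K[N]}]_(rank i.+1, rank i);
  gaug : 'cV[{mpoly K[N]}]_(rank 0)
}.

Section Resolution.

Variables (K : fieldType) (N : nat).
Implicit Types (I : {mpoly K[N]} -> Prop) (F : gcomplex K N).

(* Maps are homogeneous of degree 0: the (a, b) entry of [gdiff F i] is zero or
   homogeneous of degree gdeg F i.+1 a - gdeg F i b. *)
Definition homogeneous_maps F : Prop :=
  (forall i a b, forall mon, mon \in msupp (gdiff F i a b) ->
     (mdeg mon + gdeg b = gdeg a)%N) /\
  (forall b, gaug F b 0 \is (gdeg b).-homog).

(* Exactness of ... -> F_1 -> F_0 -> S/I -> 0 *)
Definition resolves I F : Prop :=
  [/\ forall p : {mpoly K[N]}, exists v : 'rV_(rank F 0),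
        I ((v *m gaug F) 0 0 - p),
      forall v : 'rV_(rank F 0),
        I ((v *m gaug F) 0 0) <-> exists w, v = w *m gdiff F 0
    & forall i (v : 'rV_(rank F i.+1)),
        v *m gdiff F i = 0 <-> exists w, v = w *m gdiff F i.+1].

(* The image of F_(i+1) lies in (X_0, ..., X_(N-1)) F_i: no entry has a
   constant term. *)
Definition minimal_maps F : Prop := forall i a b, (gdiff F i a b)@_0%MM = 0.

Definition minimal_graded_free_resolution I F : Prop :=
  [/\ homogeneous_maps F, resolves I F & minimal_maps F].

Definition zero_gcomplex : gcomplex K N :=
  @GComplex K N (fun=> 0%N) (fun _ _ => 0%N) (fun=> 0) 0.

Definition min_res I : gcomplex K N :=
  epsilon (inhabits zero_gcomplex) (minimal_graded_free_resolution I).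

(* beta_{i,j}(S/I): the number of copies of S(-j) in F_i, for F a minimal graded
   free resolution of S/I (unique up to isomorphism) *)
Definition betti I (i j : nat) : nat :=
  #|[set a : 'I_(rank (min_res I) i) | gdeg a == j]|.

(* pd(S/I) = max {i | beta_{i,j}(S/I) <> 0 for some j} *)
Definition is_pd I (d : nat) : Prop :=
  (exists j, betti I d j <> 0%N) /\
  (forall i j, betti I i j <> 0%N -> (i <= d)%N).

(* reg(S/I) = max {j | beta_{i,i+j}(S/I) <> 0 for some i}; negative j are
   bounded by r : nat anyway *)
Definition is_reg I (r : nat) : Prop :=
  (exists i, betti I i (i + r) <> 0%N) /\
  (forall i j, betti I i (i + j) <> 0%N -> (j <= r)%N).

End Resolution.

(* S = K[x_1, ..., x_n, y_1, ..., y_n] is {mpoly K[n + n]}, the x's being the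
   first n variables and the y's the last n. *)
Definition xvar (K : fieldType) (n : nat) (i : 'I_n) : {mpoly K[n + n]} :=
  'X_(lshift n i).
Definition yvar (K : fieldType) (n : nat) (i : 'I_n) : {mpoly K[n + n]} :=
  'X_(rshift n i).

Definition binomial_edge_ideal (K : fieldType) (n : nat) (e : rel 'I_n)
    (p : {mpoly K[n + n]}) : Prop :=
  exists c : 'I_n -> 'I_n -> {mpoly K[n + n]},
    p = \sum_(i < n) \sum_(j < n | (i < j)%N && e i j)
          c i j * (xvar K i * yvar K j - xvar K j * yvar K i).

(* K_m together with, for each handle i, a path on t i vertices *)
Definition lollipop_vertex (m k : nat) (t : 'I_k -> nat) : finType :=
  ('I_m + {i : 'I_k & 'I_(t i)})%type.

(* Handle i is attached at v i by its vertex number 0. *)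
Definition lollipop_adj (m k : nat) (t : 'I_k -> nat) (v : 'I_k -> 'I_m) :
    rel (lollipop_vertex m t) :=
  fun a b => match a, b with
  | inl a, inl b => a != b
  | inl a, inr q | inr q, inl a =>
      (a == v (tag q)) && (nat_of_ord (tagged q) == 0%N)
  | inr p, inr q =>
      (tag p == tag q) &&
      (((tagged p).+1 == tagged q :> nat) || ((tagged q).+1 == tagged p :> nat))
  end.

(* The graph e on 'I_n is a (relabelled) k-handle lollipop L_{m,t_1,...,t_k};
   in particular n = m + \sum_i t i. *)
Definition is_lollipop (m k : nat) (t : 'I_k -> nat) (n : nat) (e : rel 'I_n) :
    Prop :=
  exists (v : 'I_k -> 'I_m) (f : lollipop_vertex m t -> 'I_n),
    [/\ injective v, bijective f
      & forall a b, e (f a) (f b) = lollipop_adj v a b].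

(* Main.v *)
Require Import Defs.
From HB Require Import structures.
From mathcomp Require Import all_boot all_order all_algebra.
From mathcomp Require Import mpoly ring zify.
From Stdlib Require Import ClassicalEpsilon.

(** The lollipop is built from K_m by repeatedly joining a new vertex w to a free
    vertex v (one whose neighbours form a clique).  If v is free in G and w is
    isolated, then f = x_v y_w - x_w y_v is a nonzerodivisor modulo J_G, so the
    mapping cone of multiplication by f on the minimal resolution of S/J_G is the
    minimal resolution of S/J_(G + vw): each handle vertex multiplies the
    bigraded Poincare series by 1 + s z^2.  Regularity of f follows from Ohtani's
    formula J_G = J_(G_u) \cap ((x_u, y_u) + J_(G - u)), where G_u completes the
    neighbourhood of a non-free vertex u: this reduces to disjoint unions of
    cliques, where J_G is the kernel of a monomial map.  For K_m the resolution
    is the Eagon-Northcott complex.  It is the first quadrant of the double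
    complex of the Koszul differentials of x and y on exterior powers of S^m,
    and is exact because in positive exterior degree an element killed by both
    differentials lies in the image of their composite.  Betti numbers are read
    off since two minimal graded resolutions have the same graded ranks. *)

Set Implicit Arguments.
Unset Strict Implicit.
Unset Printing Implicit Defensive.

Import GRing.Theory.
Local Open Scope ring_scope.

(** * Restriction of polynomials to a set of monomials *)

Section Restriction.

Variables (K : fieldType) (N : nat).
Implicit Types (p q : {mpoly K[N]}) (Q : pred 'X_{1..N}).

Definition restr Q p : {mpoly K[N]} :=
  \sum_(mon <- msupp p | Q mon) p@_mon *: 'X_[mon].

Lemma mcoeff_restr Q p mon : (restr Q p)@_mon = if Q mon then p@_mon else 0.
Proof.
rewrite /restr raddf_sum /=.
under eq_bigr => i _ do rewrite mcoeffZ mcoeffX.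
rewrite -big_filter; case: ifP => Qm.
  case: (boolP (mon \in msupp p)) => [mp|mNp].
    rewrite (big_rem mon) ?mem_filter ?Qm //= eqxx mulr1 big1_seq ?addr0 // => i.
    move=> /andP[_]; rewrite mem_rem_uniq ?filter_uniq ?msupp_uniq // inE.
    by move=> /andP[/negPf-> _]; rewrite mulr0.
  rewrite memN_msupp_eq0 // big1_seq // => i /andP[_].
  rewrite mem_filter => /andP[_ ip]; case: eqVneq => [ei|]; last by rewrite mulr0.
  by rewrite ei (negPf mNp) in ip.
rewrite big1_seq // => i /andP[_]; rewrite mem_filter => /andP[Qi _].
by case: eqVneq => [ei|]; rewrite ?mulr0 //; rewrite ei Qm in Qi.
Qed.

Lemma restrD Q : {morph restr Q : p q / p + q}.
Proof.
by move=> p q; apply/mpolyP => x; rewrite !(mcoeffD, mcoeff_restr); case: ifP; rewrite ?addr0.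
Qed.

Lemma restr0 Q : restr Q 0 = 0.
Proof. by apply/mpolyP => x; rewrite mcoeff_restr mcoeff0 if_same. Qed.

Lemma restrN Q : {morph restr Q : p / - p}.
Proof.
by move=> p; apply/mpolyP => x; rewrite !(mcoeffN, mcoeff_restr); case: ifP; rewrite ?oppr0.
Qed.

Lemma restr_sum Q (I : Type) (r : seq I) (P : pred I) (F : I -> {mpoly K[N]}) :
  restr Q (\sum_(i <- r | P i) F i) = \sum_(i <- r | P i) restr Q (F i).
Proof. by apply: (big_morph _ (restrD Q) (restr0 Q)). Qed.

Lemma restr_id Q p : (forall mon, mon \in msupp p -> Q mon) -> restr Q p = p.
Proof.
move=> Qp; apply/mpolyP => x; rewrite mcoeff_restr; case: ifP => // QNx.
by rewrite memN_msupp_eq0 //; apply/negP => /Qp; rewrite QNx.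
Qed.

Lemma msupp_restr Q p mon : mon \in msupp (restr Q p) -> Q mon.
Proof. by rewrite mcoeff_msupp mcoeff_restr; case: ifP; rewrite ?eqxx. Qed.

Lemma restrZX Q (c : K) mon :
  restr Q (c *: 'X_[mon]) = if Q mon then c *: 'X_[mon] else 0.
Proof.
apply/mpolyP => x; rewrite mcoeff_restr; case: (boolP (mon == x)) => [/eqP->|nx].
  by case: ifP; rewrite ?mcoeff0.
have e0 : (c *: 'X_[mon] : {mpoly K[N]})@_x = 0.
  by rewrite mcoeffZ mcoeffX (negPf nx) mulr0.
by rewrite e0 if_same; case: ifP; rewrite ?mcoeff0.
Qed.

(** Each monomial of the product is a monomial of [p] shifted by one of [q], and by hypothesis the
    shift turns [Q] into [Q']. This one fact serves both for homogeneous components and for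
    truncation by partial degree. *)
Lemma restrM Q Q' p q :
    (forall x y, y \in msupp q -> Q (x + y)%MM = Q' x) ->
  restr Q (p * q) = restr Q' p * q.
Proof.
move=> QQ'; rewrite [in LHS](mpolyE p) mulr_suml restr_sum [restr Q' p]/restr mulr_suml.
rewrite [RHS]big_mkcond; apply: eq_bigr => x _ /=.
rewrite {1}(mpolyE q) mulr_sumr restr_sum.
have e y : y \in msupp q -> restr Q (p@_x *: 'X_[x] * (q@_y *: 'X_[y])) =
    (if Q' x then p@_x *: 'X_[x] * (q@_y *: 'X_[y]) else 0).
  move=> yq; rewrite -scalerAl -scalerAr scalerA -mpolyXD restrZX QQ' //.
rewrite big_seq (eq_bigr _ e) -big_seq; case: ifP => _; last by rewrite big1.
by rewrite -mulr_sumr -mpolyE.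
Qed.

End Restriction.

(** * Uniqueness of graded Betti numbers *)

Section GradedMatrices.

Variables (K : fieldType) (N : nat).
Local Notation S := {mpoly K[N]}.

(* [A] maps a free module with generators in degrees [dr] to one with generators
   in degrees [dc], and preserves degrees. *)
Definition gmx r c (dr : 'I_r -> nat) (dc : 'I_c -> nat) (A : 'M[S]_(r, c)) :=
  forall a b mon, mon \in msupp (A a b) -> (mdeg mon + dc b = dr a)%N.

(** The degree 0 component of a map between graded free modules; it turns an arbitrary lift into a
    homogeneous one. *)
Definition gmx_part r c (dr : 'I_r -> nat) (dc : 'I_c -> nat)
    (A : 'M[S]_(r, c)) : 'M[S]_(r, c) :=
  \matrix_(a, b) restr (fun mon => (mdeg mon + dc b == dr a)%N) (A a b).

Lemma gmx_partP r c (dr : 'I_r -> nat) (dc : 'I_c -> nat) A :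
  gmx dr dc (gmx_part dr dc A).
Proof. by move=> a b mon; rewrite mxE => /msupp_restr/eqP. Qed.

Lemma gmx_part_id r c (dr : 'I_r -> nat) (dc : 'I_c -> nat) A :
  gmx dr dc A -> gmx_part dr dc A = A.
Proof.
move=> gA; apply/matrixP => a b; rewrite mxE restr_id // => mon /gA ->.
exact: eqxx.
Qed.

Lemma gmx_part_mul r c l (dr : 'I_r -> nat) (dc : 'I_c -> nat)
    (dl : 'I_l -> nat) A D :
  gmx dc dl D -> gmx_part dr dl (A *m D) = gmx_part dr dc A *m D.
Proof.
move=> gD; apply/matrixP => a b; rewrite !mxE restr_sum; apply: eq_bigr => k _.
rewrite mxE; apply: restrM => x y /gD <-; rewrite mdegD addnA //.
Qed.

Lemma row_lift r c l (V : 'M[S]_(r, l)) (D : 'M[S]_(c, l)) :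
  (forall a, exists w, row a V = w *m D) -> exists W, V = W *m D.
Proof.
move=> /fin_all_exists[w Vw]; exists (\matrix_a w a).
by apply/row_matrixP => a; rewrite row_mul rowK.
Qed.

Lemma gmx_lift r c l (dr : 'I_r -> nat) (dc : 'I_c -> nat) (dl : 'I_l -> nat) V D :
    gmx dr dl V -> gmx dc dl D -> (exists W, V = W *m D) ->
  exists2 W, gmx dr dc W & V = W *m D.
Proof.
move=> gV gD [W VW]; exists (gmx_part dr dc W); first exact: gmx_partP.
by rewrite -(gmx_part_mul dr W gD) -VW gmx_part_id.
Qed.

(** In a row of degree [j], [A] vanishes outside the columns of degree [j], so the degree [j] blocks
    still multiply to the identity, which forces the rank inequality. *)
Lemma leq_card_deg r c (dr : 'I_r -> nat) (dc : 'I_c -> nat)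
    (A : 'M[K]_(r, c)) (B : 'M[K]_(c, r)) j :
    (forall a b, A a b != 0 -> dr a = dc b) -> A *m B = 1%:M ->
  (#|[set a | dr a == j]| <= #|[set b | dc b == j]|)%N.
Proof.
move=> gA AB1; set X := [set a | _]; set Y := [set b | _].
pose A' := \matrix_(i < #|X|, k < #|Y|) A (enum_val i) (enum_val k).
pose B' := \matrix_(k < #|Y|, i < #|X|) B (enum_val k) (enum_val i).
suff /mulmx1_min : A' *m B' = 1%:M by []; apply/matrixP => i i'; rewrite !mxE.
under eq_bigr => k _ do rewrite !mxE.
rewrite -(big_enum_val (A := mem Y) (fun b => A (enum_val i) b * B b (enum_val i'))) /=.
have /matrixP/(_ (enum_val i) (enum_val i')) := AB1; rewrite !mxE.
rewrite (inj_eq enum_val_inj) => <-; rewrite [RHS](bigID (mem Y)) /=.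
rewrite [X in _ + X]big1 ?addr0 // => b; rewrite inE => nb.
apply/eqP; rewrite mulf_eq0; apply/orP; left; apply: contraR nb => /gA <-.
by have := enum_valP i; rewrite inE.
Qed.

End GradedMatrices.

(** * Ideals and graded ideals as predicates *)

Section Ideals.

Variables (K : fieldType) (N : nat).
Implicit Types I : {mpoly K[N]} -> Prop.

Definition is_ideal I : Prop :=
  [/\ I 0, forall p q, I p -> I q -> I (p + q) & forall p q, I q -> I (p * q)].

Definition is_graded I : Prop :=
  forall d p, I p -> I (restr (fun mon => mdeg mon == d) p).

Lemma idealN I p : is_ideal I -> I p -> I (- p).
Proof. by case=> _ _ IM Ip; rewrite -mulN1r; apply: IM. Qed.

Lemma idealB I p q : is_ideal I -> I p -> I q -> I (p - q).
Proof. by move=> idI Ip Iq; case: (idI) => _ ID _; apply: ID => //; apply: idealN. Qed.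

Lemma ideal_sum I (J : Type) (r : seq J) (P : pred J) F :
  is_ideal I -> (forall i, P i -> I (F i)) -> I (\sum_(i <- r | P i) F i).
Proof. by move=> [I0 ID _] IF; apply: big_ind. Qed.

End Ideals.

(** * Comparison of two minimal graded resolutions *)

Section Uniqueness.

Variables (K : fieldType) (N : nat).
Local Notation S := {mpoly K[N]}.
Variables (I : S -> Prop) (idI : is_ideal I) (grI : is_graded I).
Implicit Types F : gcomplex K N.

(* [phi] and [psi] are the components in homological degree [i] of chain maps
   lifting the identity, and [1 - phi *m psi] is null-homotopic. *)
Definition comparison F F' i (phi : 'M[S]_(rank F i, rank F' i))
    (psi : 'M[S]_(rank F' i, rank F i)) : Prop :=
  [/\ gmx (@gdeg _ _ F i) (@gdeg _ _ F' i) phi,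
      exists phi', gdiff F i *m phi = phi' *m gdiff F' i,
      exists h, gdiff F i *m (1%:M - phi *m psi) = gdiff F i *m h *m gdiff F i
    & forall a b, ((1%:M - phi *m psi) a b)@_0%MM = 0].

Arguments comparison F F' i phi psi : clear implicits.

Lemma mcoeff0_mulmx r c l (A : 'M[S]_(r, c)) (B : 'M[S]_(c, l)) :
  (forall a b, (B a b)@_0%MM = 0) -> forall a b, ((A *m B) a b)@_0%MM = 0.
Proof.
move=> B0 a b; rewrite mxE raddf_sum big1 // => k _.
by rewrite /= (mcoeff0_is_multiplicative _ _).1 B0 mulr0.
Qed.

(** Taking constant terms turns [phi *m psi] into the identity, and a nonzero constant entry of
    [phi] can only join generators of equal degree. *)
Lemma comparison_leq F F' (i : nat) phi psi (j : nat) : comparison F F' i phi psi ->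
  (#|[set a : 'I_(rank F i) | gdeg a == j]|
     <= #|[set a : 'I_(rank F' i) | gdeg a == j]|)%N.
Proof.
case=> gphi _ _ c0.
apply: (@leq_card_deg _ _ _ _ _ (map_mx (mcoeff 0%MM) phi)
          (map_mx (mcoeff 0%MM) psi)) => [a b|].
  by rewrite mxE -mcoeff_msupp => /gphi; rewrite mdeg0 add0n.
rewrite -map_mxM; move: (phi *m psi) c0 => X c0; apply/matrixP => a b.
have /eqP := c0 a b.
rewrite !mxE mcoeffB subr_eq0 => /eqP e; apply: etrans (esym e) _.
by case: (a == b); rewrite /= ?mcoeff1 ?eqxx ?mcoeff0.
Qed.

Lemma gmx_gaug F : homogeneous_maps F ->
  gmx (@gdeg _ _ F 0) (fun=> 0%N) (gaug F).
Proof.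
by case=> _ ag a b mon; rewrite ord1 addn0; move: mon; apply/dhomogP.
Qed.

(** Lift the generators through the surjection onto S/I, then keep the homogeneous component of the
    lift: the error stays in [I] because [I] is graded. *)
Lemma aug_lift F F' : homogeneous_maps F -> homogeneous_maps F' ->
    resolves I F' ->
  exists2 phi, gmx (@gdeg _ _ F 0) (@gdeg _ _ F' 0) phi
    & forall a b, I ((phi *m gaug F' - gaug F) a b).
Proof.
move=> hF hF' [s _ _].
have /fin_all_exists[w Iw] a := s (gaug F a 0).
exists (gmx_part (@gdeg _ _ F 0) (@gdeg _ _ F' 0) (\matrix_a w a)).
  exact: gmx_partP.
move=> a b; rewrite -(gmx_part_mul _ _ (gmx_gaug hF')) -(gmx_part_id (gmx_gaug hF)).
rewrite !mxE -restrN -restrD ord1; under eq_bigr do rewrite mxE.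
move: (grI (gdeg a) (Iw a)); rewrite mxE; congr (I _).
by apply: eq_bigl => mon; rewrite addn0.
Qed.

Lemma ideal_mulmx r c l (A : 'M[S]_(r, c)) (D : 'M[S]_(c, l)) :
  (forall a b, I (D a b)) -> forall a b, I ((A *m D) a b).
Proof.
by move=> ID a b; rewrite mxE; apply: ideal_sum => // k _; case: idI => _ _; apply.
Qed.

(** Since [phi *m psi] respects the augmentation modulo [I], [1%:M - phi *m psi] factors through
    [gdiff F 0], whose entries have no constant term. *)
Lemma comparison0 F F' phi psi :
    resolves I F -> minimal_maps F -> resolves I F' ->
    gmx (@gdeg _ _ F 0) (@gdeg _ _ F' 0) phi ->
    (forall a b, I ((phi *m gaug F' - gaug F) a b)) ->
    (forall a b, I ((psi *m gaug F - gaug F') a b)) ->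
  comparison F F' 0 phi psi.
Proof.
move=> [_ ex0 _] mF [_ ex0' _] gphi Iphi Ipsi; have [_ ID IM] := idI.
have [h eh] : exists h, 1%:M - phi *m psi = h *m gdiff F 0.
  apply: row_lift => a; apply/ex0; rewrite -row_mul mxE mulmxBl mul1mx -mulmxA.
  have -> : gaug F - phi *m (psi *m gaug F) =
     - (phi *m (psi *m gaug F - gaug F') + (phi *m gaug F' - gaug F)).
    by rewrite mulmxBr addrA subrK opprB.
  by rewrite mxE; apply: idealN => //; rewrite mxE; apply: ID => //; apply: ideal_mulmx.
split=> //.
- apply: row_lift => a; apply/ex0'; rewrite -row_mul mxE -mulmxA.
  rewrite -[phi *m _](subrK (gaug F)) mulmxDr mxE; apply: ID.
    exact: ideal_mulmx.
  have /ex0 : exists w, row a (gdiff F 0) = w *m gdiff F 0.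
    by exists (delta_mx 0 a); rewrite -rowE.
  by rewrite -row_mul mxE.
- by exists h; rewrite eh mulmxA.
- by rewrite eh; apply: mcoeff0_mulmx.
Qed.

Lemma exact_lift F i c (V : 'M[S]_(c, rank F i.+1)) : resolves I F ->
  V *m gdiff F i = 0 -> exists W, V = W *m gdiff F i.+1.
Proof.
move=> [_ _ ex] V0; apply: row_lift => a; apply/ex.
by rewrite -row_mul V0 row0.
Qed.

Lemma gdiff_comp F i : resolves I F -> gdiff F i.+1 *m gdiff F i = 0.
Proof.
move=> [_ _ ex]; apply/row_matrixP => a; rewrite row0 row_mul; apply/ex.
by exists (delta_mx 0 a); rewrite -rowE.
Qed.

Lemma comparisonS F F' (i : nat) phi psi phi' psi' :
    resolves I F -> minimal_maps F -> resolves I F' ->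
    comparison F F' i phi psi ->
    gmx (@gdeg _ _ F i.+1) (@gdeg _ _ F' i.+1) phi' ->
    gdiff F i *m phi = phi' *m gdiff F' i ->
    gdiff F' i *m psi = psi' *m gdiff F i ->
  comparison F F' i.+1 phi' psi'.
Proof.
move=> rF mF rF' [_ _ [h eh] _] gphi' e e'.
(* The homotopy [h] from degree [i] corrects [1%:M - phi' *m psi'] to a cycle; exactness then gives
   the next homotopy [h'], and minimality kills the constant terms of both summands. *)
have [h' eh'] : exists h', 1%:M - phi' *m psi' - gdiff F i *m h = h' *m gdiff F i.+1.
  apply: exact_lift => //; rewrite mulmxBl -eh mulmxBl mul1mx -mulmxA -e' mulmxA -e.
  by rewrite mulmxBr mulmx1 mulmxA subrr.
have {}eh' : 1%:M - phi' *m psi' = gdiff F i *m h + h' *m gdiff F i.+1.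
  by rewrite -eh' [RHS]addrC subrK.
split=> //.
- apply: exact_lift => //; rewrite -mulmxA -e mulmxA gdiff_comp //.
  by rewrite mul0mx.
- exists h'; rewrite eh' mulmxDr !mulmxA gdiff_comp //.
  by rewrite mul0mx add0r.
- move=> a b; rewrite eh' mxE mcoeffD (mcoeff0_mulmx _ (mF _)) addr0.
  rewrite mxE raddf_sum big1 // => k _.
  by rewrite /= (mcoeff0_is_multiplicative _ _).1 mF mul0r.
Qed.

Lemma comparison_ex F F' i :
    minimal_graded_free_resolution I F -> minimal_graded_free_resolution I F' ->
  exists phi psi, comparison F F' i phi psi /\ comparison F' F i psi phi.
Proof.
move=> [hF rF mF] [hF' rF' mF']; elim: i => [|i [phi [psi [c c']]]].
  have [phi gphi Iphi] := aug_lift hF hF' rF'.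
  have [psi gpsi Ipsi] := aug_lift hF' hF rF.
  by exists phi, psi; split; apply: comparison0.
have [gphi e _ _] := c; have [gpsi e' _ _] := c'.
have gm r l k (dr : 'I_r -> nat) (dl : 'I_l -> nat) (dk : 'I_k -> nat) A B :
  gmx dr dl A -> gmx dl dk B -> gmx dr dk (A *m B : 'M[S]_(_, _)).
  move=> gA gB; rewrite -(gmx_part_id gA) -(gmx_part_mul _ _ gB); exact: gmx_partP.
have [phi' g1 e1] := gmx_lift (gm _ _ _ _ _ _ _ _ (hF.1 i) gphi) (hF'.1 i) e.
have [psi' g2 e2] := gmx_lift (gm _ _ _ _ _ _ _ _ (hF'.1 i) gpsi) (hF.1 i) e'.
exists phi', psi'; split; first exact: (comparisonS rF mF rF' c g1 e1 e2).
exact: (comparisonS rF' mF' rF c' g2 e2 e1).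
Qed.

(** The existence of [F] makes the choice by [epsilon] a genuine minimal resolution; comparison maps
    in both directions give the two inequalities. *)
Lemma betti_eq F i j : minimal_graded_free_resolution I F ->
  betti I i j = #|[set a : 'I_(rank F i) | gdeg a == j]|.
Proof.
move=> hF; have hM : minimal_graded_free_resolution I (min_res I).
  by apply: epsilon_spec; exists F.
have [phi [psi [c c']]] := comparison_ex i hM hF.
by apply/eqP; rewrite eqn_leq (comparison_leq j c) (comparison_leq j c').
Qed.

End Uniqueness.

(** * Mapping cones *)

Section ConeMatrices.

Variables (A : comNzRingType) (p q r s : nat).

(** Two independent sets of maps and scalars are allowed, so that the identity shows both that a
    cone is a complex and that two Koszul differentials anticommute. *)
Lemma mulmx_cone (a2 : 'M[A]_(p, q)) (a1 b1 : 'M_(q, r)) (b0 : 'M_(r, s)) c d :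
  block_mx a2 0 c%:M (- a1) *m block_mx b1 0 d%:M (- b0) =
  block_mx (a2 *m b1) 0 (c *: b1 - d *: a1) (a1 *m b0).
Proof.
rewrite mulmx_block !mulmx0 !mul0mx !addr0 add0r mulmxN !mulNmx opprK.
by rewrite mul_scalar_mx mul_mx_scalar.
Qed.

Lemma mulmx_cone0 (a2 : 'M[A]_(p, q)) (a1 b1 : 'M_(q, r)) c d :
  block_mx a2 0 c%:M (- a1) *m col_mx b1 d%:M =
  col_mx (a2 *m b1) (c *: b1 - d *: a1).
Proof.
by rewrite mul_block_col mul0mx addr0 mulNmx mul_scalar_mx mul_mx_scalar.
Qed.

Variables (f : A) (D3 : 'M[A]_(p, q)) (D2 : 'M[A]_(q, r)) (D1 : 'M[A]_(r, s)).
Hypothesis ex2 : forall v : 'rV_q, v *m D2 = 0 -> exists w, v = w *m D3.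

(** At the end of the cone, [reg] says that [f] is regular on the cokernel of [D2]. It gives
    [b = w *m D2], and then [a + f *: w] is a cycle for [D2]. *)
Lemma cone_exact_col (v : 'rV_(q + r)) :
    (forall b : 'rV_r, (exists w, f *: b = w *m D2) -> exists w, b = w *m D2) ->
    v *m col_mx D2 f%:M = 0 ->
  exists w, v = w *m block_mx D3 0 f%:M (- D2).
Proof.
move=> reg; rewrite -[v]hsubmxK; move: (lsubmx v) (rsubmx v) => a b.
rewrite mul_row_col mul_mx_scalar => e.
have [|w ew] := reg b.
  by exists (- a); rewrite mulNmx -[f *: b](addKr (a *m D2)) e addr0.
have [|w' ew'] := ex2 (v := a + f *: w); first by rewrite mulmxDl -scalemxAl -ew.
exists (row_mx w' (- w)); rewrite mul_row_block mulmx0 add0r !mulNmx mulmxN opprK.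
by rewrite -ew -ew' mul_mx_scalar addrK.
Qed.

Lemma cone_exact_block (v : 'rV_(q + r)) :
    (forall b : 'rV_r, b *m D1 = 0 -> exists w, b = w *m D2) ->
    v *m block_mx D2 0 f%:M (- D1) = 0 ->
  exists w, v = w *m block_mx D3 0 f%:M (- D2).
Proof.
move=> ex1; rewrite -[v]hsubmxK; move: (lsubmx v) (rsubmx v) => a b.
rewrite mul_row_block mulmx0 add0r mul_mx_scalar mulmxN -row_mx0.
move=> /eq_row_mx[e /eqP]; rewrite oppr_eq0 => /eqP/ex1[w ew].
have [|w' ew'] := ex2 (v := a + f *: w); first by rewrite mulmxDl -scalemxAl -ew.
exists (row_mx w' (- w)); rewrite mul_row_block mulmx0 add0r !mulNmx mulmxN opprK.
by rewrite -ew -ew' mul_mx_scalar addrK.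
Qed.

End ConeMatrices.

(** * The mapping cone of multiplication by a homogeneous nonzerodivisor modulo [I] *)

Section Cone.

Variables (K : fieldType) (N : nat).
Local Notation S := {mpoly K[N]}.

Definition nb_gens (F : gcomplex K N) (i j : nat) : nat :=
  #|[set a : 'I_(rank F i) | gdeg a == j]|.

Lemma nb_gensE F i j : nb_gens F i j = (\sum_(a < rank F i) (gdeg a == j))%N.
Proof.
rewrite /nb_gens -sum1_card big_mkcond; apply: eq_bigr => a _.
by rewrite inE; case: eqP.
Qed.

Variables (f : S) (d : nat) (F : gcomplex K N).

Definition cone_rank i : nat :=
  if i is i'.+1 then (rank F i'.+1 + rank F i')%N else rank F 0.

Definition cone_deg i : 'I_(cone_rank i) -> nat :=
  match i with
  | 0 => @gdeg _ _ F 0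
  | i'.+1 => fun a => match split a with
                      | inl b => gdeg b
                      | inr b => (gdeg b + d)%N
                      end
  end.

Definition cone_diff i : 'M[S]_(cone_rank i.+1, cone_rank i) :=
  match i with
  | 0 => col_mx (gdiff F 0) f%:M
  | i'.+1 => block_mx (gdiff F i'.+1) 0 f%:M (- gdiff F i')
  end.

Definition cone : gcomplex K N :=
  @GComplex K N cone_rank cone_deg cone_diff (gaug F).

Lemma cone_degl i (a : 'I_(rank F i.+1)) :
  @cone_deg i.+1 (lshift (rank F i) a) = gdeg a.
Proof. by rewrite /cone_deg (unsplitK (inl a)). Qed.

Lemma cone_degr i (a : 'I_(rank F i)) :
  @cone_deg i.+1 (rshift (rank F i.+1) a) = (gdeg a + d)%N.
Proof. by rewrite /cone_deg (unsplitK (inr a)). Qed.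

Lemma nb_gens_cone0 j : nb_gens cone 0 j = nb_gens F 0 j.
Proof. by []. Qed.

Lemma nb_gens_coneS i j : nb_gens cone i.+1 j =
  (nb_gens F i.+1 j + if d <= j then nb_gens F i (j - d) else 0)%N.
Proof.
rewrite !nb_gensE big_split_ord; congr addn.
  by apply: eq_bigr => a _; rewrite -cone_degl.
case: leqP => dj; last first.
  rewrite big1 // => a _; case: eqP => //; rewrite [gdeg _]cone_degr => e.
  by move: dj; rewrite -e ltnNge leq_addl.
by apply: eq_bigr => a _; rewrite [gdeg _]cone_degr; congr nat_of_bool; lia.
Qed.

Variables (I I' : S -> Prop) (idI : is_ideal I).
Hypotheses (f_homog : f \is d.-homog) (d_gt0 : (0 < d)%N).
Hypothesis f_regular : forall p, I (f * p) -> I p.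
Hypothesis I'E : forall p, I' p <-> exists q, I (p - f * q).
Hypothesis resF : minimal_graded_free_resolution I F.

Lemma f_diag_homog r (dr : 'I_r -> nat) a b mon :
  mon \in msupp ((f%:M : 'M[S]_r) a b) -> (mdeg mon + dr b)%N = (dr a + d)%N.
Proof.
rewrite mxE; case: eqP => [->|_]; last by rewrite msupp0.
by move/dhomogP: f_homog => h /h /= <-; rewrite addnC.
Qed.

Lemma f_const0 r a b : ((f%:M : 'M[S]_r) a b)@_0%MM = 0.
Proof.
rewrite mxE; case: eqP => [_|_]; last by rewrite mcoeff0.
by apply: (dhomog_nemf_coeff f_homog); rewrite /= mdeg0 eq_sym -lt0n.
Qed.

Lemma cone_homogeneous : homogeneous_maps cone.
Proof.
have [[hd ha] _ _] := resF; split => // -[|i] a b mon; rewrite /gdeg /gdiff /=.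
  case: (split_ordP a) => a' ->; rewrite ?cone_degl ?cone_degr.
    by rewrite col_mxEu; apply: hd.
  by rewrite col_mxEd; apply: f_diag_homog.
case: (split_ordP a) => a' ->; case: (split_ordP b) => b' ->;
  rewrite ?cone_degl ?cone_degr.
- by rewrite block_mxEul; apply: hd.
- by rewrite block_mxEur mxE msupp0.
- by rewrite block_mxEdl; apply: f_diag_homog.
- by rewrite block_mxEdr mxE (perm_mem (msuppN _)) => /hd <-; rewrite addnA.
Qed.

Lemma cone_minimal : minimal_maps cone.
Proof.
have [_ _ m] := resF; move=> [|i] /= a b.
  by case: (split_ordP a) => a' ->; rewrite (col_mxEu, col_mxEd) ?m ?f_const0.
case: (split_ordP a) => a' ->; case: (split_ordP b) => b' ->.
- by rewrite block_mxEul m.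
- by rewrite block_mxEur mxE mcoeff0.
- by rewrite block_mxEdl f_const0.
- by rewrite block_mxEdr mxE mcoeffN m oppr0.
Qed.

Lemma cone_resolves : resolves I' cone.
Proof.
have [_ rF _] := resF; have [s ex0 ex] := rF; have [I0 ID IM] := idI.
pose ev (a : 'rV[S]_(rank F 0)) := (a *m gaug F) 0 0.
have evD a b : ev (a + b) = ev a + ev b by rewrite /ev mulmxDl mxE.
have evZ c a : ev (c *: a) = c * ev a by rewrite /ev -scalemxAl mxE.
have evN a : ev (- a) = - ev a by rewrite /ev mulNmx mxE.
split.
- move=> p; have [v Iv] := s p; exists v; apply/I'E; exists 0.
  by rewrite mulr0 subr0.
- move=> v /=; rewrite I'E -/(ev v); split.
    move=> [q Iq]; have [u Iu] := s q.
    (* The cofactor [q] is known only as a polynomial; [u] lifts it to [F_0] modulo [I], which is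
       enough. *)
    have /ex0[w ew] : I (ev (v - f *: u)).
      rewrite evD evN evZ.
      have -> : ev v - f * ev u = ev v - f * q - f * (ev u - q) by ring.
      by apply: idealB => //; apply: IM.
    by exists (row_mx w u); rewrite mul_row_col mul_mx_scalar -ew subrK.
  move=> [w ->]; rewrite -[w]hsubmxK mul_row_col mul_mx_scalar evD evZ.
  exists (ev (rsubmx w)); rewrite addrK; apply/ex0.
  by exists (lsubmx w).
- move=> [|i] v /=; split.
  + apply: cone_exact_col => [a /ex //|b [w ew]]; apply/ex0/f_regular.
    by rewrite -/(ev b) -evZ ew; apply/ex0; exists w.
  + move=> [w ->]; rewrite -mulmxA mulmx_cone0 (gdiff_comp _ rF) subrr col_mx0.
    exact: mulmx0.
  + by apply: cone_exact_block => [a /ex|a /ex].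
  + move=> [w ->]; rewrite -mulmxA mulmx_cone !(gdiff_comp _ rF) subrr.
    by rewrite block_mx_const mulmx0.
Qed.

Lemma cone_resolution : minimal_graded_free_resolution I' cone.
Proof. split; [exact: cone_homogeneous|exact: cone_resolves|exact: cone_minimal]. Qed.

End Cone.

(** * The Koszul complex *)

(* ['C(m, k)], with the recursion arranged so that [kos_rank 0 m] computes to 1
   and Pascal's rule holds by computation. *)
Fixpoint kos_rank k : nat -> nat :=
  match k with
  | 0 => fun=> 1%N
  | k'.+1 => fix rk m := match m with
                         | 0 => 0%N
                         | m'.+1 => (rk m' + kos_rank k' m')%N
                         end
  end.

Lemma kos_rankE k m : kos_rank k m = 'C(m, k).
Proof.
elim: k m => [|k IHk] m; first by rewrite bin0.
by elim: m => [|m IHm] //=; rewrite binS -IHk -IHm.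
Qed.

Arguments kos_rank : simpl never.

Section Koszul.

Variable A : comNzRingType.
Implicit Types x y : nat -> A.

(** The Koszul differential from Lambda^(k+1) to Lambda^k as an iterated mapping cone: the first
    block of the basis holds the wedges avoiding the last index, the second those containing it. *)
Fixpoint kos x m : forall k, 'M[A]_(kos_rank k.+1 m, kos_rank k m) :=
  match m return forall k, 'M[A]_(kos_rank k.+1 m, kos_rank k m) with
  | 0 => fun k => 0
  | m'.+1 => fun k =>
     match k return 'M[A]_(kos_rank k.+1 m'.+1, kos_rank k m'.+1) with
     | 0 => col_mx (kos x m' 0) (x m')%:M
     | k'.+1 => block_mx (kos x m' k'.+1) 0 (x m')%:M (- kos x m' k')
     end
  end.

Lemma kosS0 x m : kos x m.+1 0 = (col_mx (kos x m 0) (x m)%:M : 'M_(_, kos_rank 0 m)).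
Proof. by []. Qed.

Lemma kosSS x m k :
  kos x m.+1 k.+1 =
    (block_mx (kos x m k.+1) 0 (x m)%:M (- kos x m k)
       : 'M_(kos_rank k.+2 m + kos_rank k.+1 m, kos_rank k.+1 m + kos_rank k m)).
Proof. by []. Qed.

Arguments kos : simpl never.

Lemma kos_comp x m k : kos x m k.+1 *m kos x m k = 0.
Proof.
elim: m k => [|m IHm] [|k]; try by apply/matrixP => -[].
  have := mulmx_cone0 (kos x m 1) (kos x m 0) (kos x m 0) (x m) (x m).
  by rewrite IHm subrr col_mx0.
have := mulmx_cone (kos x m k.+2) (kos x m k.+1) (kos x m k.+1) (kos x m k) (x m) (x m).
by rewrite !IHm subrr block_mx_const.
Qed.

(** In the block product the lower left entry is antisymmetric under exchanging [x] and [y]; the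
    diagonal blocks follow by induction. *)
Lemma kos_anti x y m k :
  kos x m k.+1 *m kos y m k = - (kos y m k.+1 *m kos x m k).
Proof.
elim: m k => [|m IHm] [|k]; try by apply/matrixP => -[].
  have e a b := mulmx_cone0 (kos a m 1) (kos a m 0) (kos b m 0) (a m) (b m).
  apply: etrans (e x y) _; apply: etrans (congr1 -%R (esym (e y x))).
  by rewrite opp_col_mx opprB IHm.
have e a b := mulmx_cone (kos a m k.+2) (kos a m k.+1) (kos b m k.+1) (kos b m k)
  (a m) (b m).
apply: etrans (e x y) _; apply: etrans (congr1 -%R (esym (e y x))).
by rewrite opp_block_mx opprB !IHm oppr0.
Qed.

(* [v] has length 1, and the row space of [kos x i 0] is the ideal generated by
   x 0, ..., x (i - 1). *)
Definition regular_seq x m : Prop := forall i, (i < m)%N ->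
  forall v : 'rV[A]_(kos_rank 0 i), (exists u, x i *: v = u *m kos x i 0) ->
  exists u, v = u *m kos x i 0.

(** Each new element adds one cone; its regularity enters at [k = 0], while higher degrees use
    exactness of the smaller complex alone. *)
Lemma kos_exact x m k (v : 'rV[A]_(kos_rank k.+1 m)) : regular_seq x m ->
  v *m kos x m k = 0 -> exists u, v = u *m kos x m k.+1.
Proof.
elim: m k v => [|m IHm] k v reg; first by exists 0; apply/matrixP => i [].
have {}IHm := IHm _ _ (fun i im => reg i (ltnW im)).
case: k v => [|k] v.
  apply: (cone_exact_col (IHm 0%N)) => b; exact: (reg m).
exact: (cone_exact_block (IHm k.+1) (IHm k)).
Qed.

End Koszul.

Arguments kos : simpl never.

(** * Koszul complexes on distinct variables *)

Section KoszulVariables.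

Variables (K : fieldType) (N : nat).
Local Notation S := {mpoly K[N]}.
Local Notation X a := (fun l : nat => 'X_(a l) : S).
Implicit Types (a b : nat -> 'I_N) (Q : pred 'X_{1..N}).

Lemma restr_mulmx Q Q' r c l (A : 'M[S]_(r, c)) (D : 'M[S]_(c, l)) :
    (forall i j x y, y \in msupp (D i j) -> Q (x + y)%MM = Q' x) ->
  map_mx (restr Q) (A *m D) = map_mx (restr Q') A *m D.
Proof.
move=> QQ'; apply/matrixP => i j; rewrite !mxE restr_sum.
by apply: eq_bigr => k _; rewrite mxE (@restrM _ _ _ Q') //; apply: QQ'.
Qed.

Lemma msupp_mul_mx r (p : S) (i j : 'I_r) mon :
  mon \in msupp ((p%:M : 'M_r) i j) -> mon \in msupp p.
Proof. by rewrite mxE; case: eqP => // _; rewrite msupp0. Qed.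

Lemma msupp_kos a m k i j mon :
  mon \in msupp (kos (X a) m k i j) -> exists2 l, (l < m)%N & mon = U_(a l)%MM.
Proof.
elim: m k i j => [|m IHm] k i j; first by case: i.
have XE r i' j' : mon \in msupp ((('X_(a m) : S)%:M : 'M_r) i' j') ->
    exists2 l, (l < m.+1)%N & mon = U_(a l)%MM.
  by move/msupp_mul_mx/mem_msuppXP => <-; exists m.
have IH k' i' j' : mon \in msupp (kos (X a) m k' i' j') ->
    exists2 l, (l < m.+1)%N & mon = U_(a l)%MM.
  by move/IHm => [l lm]; exists l => //; apply: ltnW.
case: k i j => [|k] i j.
  rewrite kosS0; case: (split_ordP i) => i' ->; first by rewrite col_mxEu; apply: IH.
  by rewrite col_mxEd; apply: XE.
rewrite kosSS; case: (split_ordP i) => i' ->; case: (split_ordP j) => j' ->.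
- by rewrite block_mxEul; apply: IH.
- by rewrite block_mxEur mxE msupp0.
- by rewrite block_mxEdl; apply: XE.
- by rewrite block_mxEdr mxE (perm_mem (msuppN _)); apply: IH.
Qed.

Lemma divX_restr (i : 'I_N) (p : S) :
  exists q, p = restr (fun mon => mon i == 0%N) p + 'X_i * q.
Proof.
exists (\sum_(mon <- msupp p | mon i != 0%N) p@_mon *: 'X_[mon - U_(i)]).
rewrite {1}(mpolyE p) (bigID (fun mon : 'X_{1..N} => mon i == 0%N)) /=; congr (_ + _).
rewrite mulr_sumr; apply: eq_bigr => mon mi.
by rewrite -scalerAr -mpolyXD addmC submK // lep1mP.
Qed.

Definition free_of a m : pred 'X_{1..N} :=
  fun mon => all (fun l => mon (a l) == 0%N) (iota 0 m).

Lemma free_of_kos a m k i j x y :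
  y \in msupp (kos (X a) m k i j) -> free_of a m (x + y)%MM = false.
Proof.
move=> /msupp_kos[l lm ->]; apply/allPn; exists l; first by rewrite mem_iota.
by rewrite mnmDE mnm1E eqxx addn1.
Qed.

Lemma restr_pred0 (p : S) : restr pred0 p = 0.
Proof. by apply/mpolyP => mon; rewrite mcoeff_restr mcoeff0. Qed.

Lemma restr_restr Q Q' (p : S) : restr Q (restr Q' p) = restr (predI Q Q') p.
Proof.
by apply/mpolyP => mon; rewrite !mcoeff_restr /=; case: (Q mon); case: (Q' mon).
Qed.

(** Turns membership in an ideal generated by variables into a condition on coefficients, from which
    regularity can be read off. *)
Lemma im_kos0E a m (v : 'rV_(kos_rank 0 m)) :
  (exists u, v = u *m kos (X a) m 0) <-> map_mx (restr (free_of a m)) v = 0.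
Proof.
split.
  move=> [u ->]; rewrite (@restr_mulmx _ pred0) => [|i j x y]; last first.
    by move/free_of_kos ->.
  rewrite (_ : map_mx _ u = 0) ?mul0mx //; apply/matrixP => i j.
  by rewrite !mxE restr_pred0.
elim: m v => [|m IHm] v.
  move=> e; exists 0; rewrite mul0mx -e; apply/matrixP => i j.
  by rewrite mxE restr_id.
move=> e; pose v' := map_mx (restr (fun mon => mon (a m) == 0%N)) v.
have [|u eu] := IHm v'.
  rewrite -e; apply/matrixP => i j; rewrite !mxE restr_restr.
  apply: eq_bigl => mon; rewrite /= /free_of -(addn1 m) iotaD all_cat /= andbT.
  by rewrite add0n.
have /fin_all_exists[w ew] j := divX_restr (a m) (v 0 j).
exists (row_mx u (\row_j w j)); rewrite kosS0 mul_row_col -eu mul_mx_scalar.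
by apply/rowP => j; rewrite !mxE -ew.
Qed.

(** Multiplying by a new variable does not change which monomials avoid the earlier ones, so it
    commutes with the restriction and cancels in a domain. *)
Lemma regular_seqX a m :
    (forall i j, (i < j < m)%N -> a i != a j) -> regular_seq (X a) m.
Proof.
move=> inj i im v /im_kos0E e; apply/im_kos0E; apply/matrixP => r j.
have /matrixP/(_ r j) := e; rewrite !mxE mulrC (@restrM _ _ _ (free_of a i)).
  by move/eqP; rewrite mulf_eq0 => /orP[/eqP //|/eqP/(congr1 (mcoeff U_(a i)))];
    rewrite mcoeffX eqxx mcoeff0 => /eqP; rewrite oner_eq0.
move=> x y /mem_msuppXP <-; apply: eq_in_all => l; rewrite mem_iota add0n => li.
by rewrite mnmDE mnm1E [a i == _]eq_sym (negPf (inj _ _ _)) ?addn0 // im andbT.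
Qed.

End KoszulVariables.

(** * Exactness from two anticommuting Koszul differentials *)

Section EagonNorthcott.

Variables (K : fieldType) (N : nat).
Local Notation S := {mpoly K[N]}.
Variables (a b : nat -> 'I_N) (m : nat).
Hypothesis a_inj : forall i j, (i < j < m)%N -> a i != a j.
Hypothesis b_inj : forall i j, (i < j < m)%N -> b i != b j.
Hypothesis ab_neq : forall i j, (i < m)%N -> (j < m)%N -> a i != b j.

Local Notation dx := (kos (fun l => 'X_(a l) : S) m).
Local Notation dy := (kos (fun l => 'X_(b l) : S) m).

Definition in_a (i : 'I_N) : bool := has (fun l => a l == i) (iota 0 m).

Definition xdeg (mon : 'X_{1..N}) : nat := (\sum_(i | in_a i) mon i)%N.

Lemma xdegDU mon i : xdeg (mon + U_(i))%MM = (xdeg mon + in_a i)%N.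
Proof.
rewrite /xdeg; under eq_bigr do rewrite mnmDE mnm1E.
rewrite big_split /=; congr addn; case: (boolP (in_a i)) => ai.
  rewrite (bigD1 i) //= eqxx big1 // => j /andP[_ ji].
  by rewrite eq_sym (negPf ji).
by rewrite big1 // => j aj; case: eqP => // ij; rewrite ij aj in ai.
Qed.

Definition xtrunc d : pred 'X_{1..N} := fun mon => (xdeg mon < d)%N.

Lemma xtrunc_dx d k l (v : 'M_(l, _)) :
  map_mx (restr (xtrunc d.+1)) (v *m dx k) = map_mx (restr (xtrunc d)) v *m dx k.
Proof.
apply: restr_mulmx => i j x y /msupp_kos[c cm ->].
rewrite /xtrunc xdegDU (_ : in_a _ = true) ?addn1 //.
by apply/hasP; exists c; rewrite ?mem_iota.
Qed.

Lemma xtrunc_dy d k l (v : 'M_(l, _)) :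
  map_mx (restr (xtrunc d)) (v *m dy k) = map_mx (restr (xtrunc d)) v *m dy k.
Proof.
apply: restr_mulmx => i j x y /msupp_kos[c cm ->].
rewrite /xtrunc xdegDU (_ : in_a _ = false) ?addn0 //.
apply/hasPn => c'; rewrite mem_iota => cm'; exact: ab_neq.
Qed.

Lemma xtrunc_large k (v : 'rV[S]_k) : exists d, map_mx (restr (xtrunc d)) v = v.
Proof.
exists (\max_j \max_(mon <- msupp (v 0%R j)) (xdeg mon).+1)%N.
apply/rowP => j; rewrite mxE restr_id // => mon monj.
by apply: leq_trans (leq_bigmax j); apply: leq_bigmax_seq.
Qed.

Lemma dx_exact k (v : 'rV_(kos_rank k.+1 m)) :
  v *m dx k = 0 -> exists u, v = u *m dx k.+1.
Proof. exact/kos_exact/regular_seqX. Qed.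

Lemma dy_exact k (v : 'rV_(kos_rank k.+1 m)) :
  v *m dy k = 0 -> exists u, v = u *m dy k.+1.
Proof. exact/kos_exact/regular_seqX. Qed.

Lemma dxx k : dx k.+1 *m dx k = 0. Proof. exact: kos_comp. Qed.
Lemma dyy k : dy k.+1 *m dy k = 0. Proof. exact: kos_comp. Qed.
Lemma dxy k : dx k.+1 *m dy k = - (dy k.+1 *m dx k). Proof. exact: kos_anti. Qed.

(* Induction on the degree in the [a]-variables: lifting [w] along [dx] lowers
   it, and [dy] of the lift is again a cycle for both differentials. *)
Lemma dxdy_exact k (w : 'rV_(kos_rank k.+1 m)) :
    w *m dx k = 0 -> w *m dy k = 0 ->
  exists u, w = u *m dy k.+2 *m dx k.+1.
Proof.
have [d dw] := xtrunc_large w; elim: d w dw => [|d IHd] w dw wx wy.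
  exists 0; rewrite !mul0mx -dw; apply/rowP => j; rewrite !mxE.
  by rewrite (_ : restr _ _ = restr pred0 (w 0 j)) ?restr_pred0 //; apply: eq_bigl.
(* As [dx] raises the degree in the [a]-variables by exactly one, truncating the lift below degree
   [d] still yields [w]. *)
have [u' eu'] := dx_exact wx; pose u := map_mx (restr (xtrunc d)) u'.
have eu : w = u *m dx k.+1 by rewrite -xtrunc_dx -eu' dw.
have [|||u2 eu2] := IHd (u *m dy k.+1).
- by rewrite xtrunc_dy; congr (_ *m _); apply/matrixP => i j; rewrite !mxE restr_restr;
    apply: eq_bigl => mon; rewrite /= andbb.
- by rewrite -mulmxA -[dy _ *m _]opprK -dxy mulmxN mulmxA -eu wy oppr0.
- by rewrite -mulmxA dyy mulmx0.
(* Adding [u2 *m dx] leaves [u *m dx] unchanged and, by anticommutation, produces a cycle for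
   [dy]. *)
have [|u3 eu3] := dy_exact (v := u + u2 *m dx k.+2).
  by rewrite mulmxDl eu2 -!mulmxA dxy mulmxN subrr.
by exists u3; rewrite -eu3 mulmxDl -eu -mulmxA dxx mulmx0 addr0.
Qed.

(** Descends the staircase from position [n] to 0: [c n - u *m dx] lifts along [dy] to some [v0],
    and the cycle relation makes [c n.-1 - v0 *m dx] a cycle for [dy] again. *)
Lemma en_descent k n (c : nat -> 'rV_(kos_rank k.+2 m)) (u : 'rV_(kos_rank k.+3 m)) :
    (forall p, (p < n)%N -> c p.+1 *m dx k.+1 + c p *m dy k.+1 = 0) ->
    (c n - u *m dx k.+2) *m dy k.+1 = 0 ->
  exists v, v n.+1 = u /\ forall p, (p <= n)%N -> c p = v p.+1 *m dx k.+2 + v p *m dy k.+2.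
Proof.
elim: n u => [|n IHn] u cyc /dy_exact[v0 ev0].
  exists (fun p => if p is 0 then v0 else u); split=> // -[|//] _.
  by rewrite -ev0 addrC subrK.
have [||v [vn ev]] := IHn v0.
- by move=> p pn; apply: cyc; apply: ltnW.
- rewrite mulmxBl -mulmxA dxy mulmxN opprK mulmxA -ev0 mulmxBl -mulmxA dxx mulmx0.
  by rewrite subr0 addrC cyc.
exists (fun p => if p == n.+2 then u else v p); split=> [|p]; first by rewrite eqxx.
rewrite leq_eqVlt => /orP[/eqP->|pn].
  by rewrite eqxx ltn_eqF // vn -ev0 addrC subrK.
by rewrite !ltn_eqF ?ev // ?ltnS // ltnW.
Qed.

(** At the corner, [c n *m dy] is killed by both differentials, hence comes from their composite;
    this supplies the starting value of the descent. *)
Lemma en_exact k n (c : nat -> 'rV_(kos_rank k.+2 m)) :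
    (forall p, (p < n)%N -> c p.+1 *m dx k.+1 + c p *m dy k.+1 = 0) ->
    c n *m dy k.+1 *m dx k = 0 ->
  exists v, forall p, (p <= n)%N -> c p = v p.+1 *m dx k.+2 + v p *m dy k.+2.
Proof.
move=> cyc corner; have [||u eu] := dxdy_exact (w := c n *m dy k.+1) => //.
  by rewrite -mulmxA dyy mulmx0.
have [|v [_ ev]] := @en_descent k n c (- u) cyc; last by exists v.
by rewrite mulmxBl eu mulNmx mulNmx opprK -!mulmxA dxy mulmxN subrr.
Qed.

End EagonNorthcott.

(** * The Eagon-Northcott complex *)

Section MinorIdeal.

Variable A : comNzRingType.
Implicit Types x y : nat -> A.

(** The composite from Lambda^2 to Lambda^0 sends a basis wedge to a 2-minor, up to sign, so this is
    the ideal of 2-minors of the matrix with rows [x] and [y]. *)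
Definition minor_ideal x y m (p : A) : Prop :=
  exists u, p = (u *m (kos y m 1 *m kos x m 0) : 'M_1) 0 0.

(** The coefficients are chosen before [x], so that the same ones serve for both rows of the
    matrix. *)
Lemma kos0_sum m (u : 'rV[A]_(kos_rank 1 m)) : exists c : nat -> A, forall x,
  (u *m kos x m 0 : 'M_1) 0 0 = \sum_(l < m) c l * x l.
Proof.
elim: m u => [|m IHm] u.
  by exists (fun=> 0) => x; rewrite big_ord0 mulmx0 mxE.
have [c ec] := IHm (@lsubmx _ 1 (kos_rank 1 m) (kos_rank 0 m) u).
pose d := (@rsubmx _ 1 (kos_rank 1 m) (kos_rank 0 m) u : 'M_1) 0 0.
exists (fun l => if l == m then d else c l) => x; rewrite big_ord_recr /= eqxx.
under eq_bigr => l _ do rewrite ltn_eqF //.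
rewrite -ec kosS0 -{1}(@hsubmxK _ 1 (kos_rank 1 m) (kos_rank 0 m) u).
rewrite mul_row_col mul_mx_scalar mxE; congr (_ + _).
by rewrite mxE mulrC.
Qed.

Lemma kos0_var m l : (l < m)%N ->
  exists u, forall x, (u *m kos x m 0 : 'M_1) 0 0 = x l.
Proof.
elim: m => // m IHm; rewrite ltnS leq_eqVlt => /orP[/eqP->|/IHm[u eu]].
  exists (row_mx 0 (1 : 'M_1)) => x; rewrite kosS0 mul_row_col mul0mx add0r mul1mx.
  by rewrite mxE eqxx.
by exists (row_mx u (0 : 'M_1)) => x; rewrite kosS0 mul_row_col mul0mx addr0 eu.
Qed.

Lemma minor_idealS x y m p : minor_ideal x y m.+1 p <->
  exists q, minor_ideal x y m q /\ exists u, p = q +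
    (y m * (u *m kos x m 0 : 'M_1) 0 0 - x m * (u *m kos y m 0 : 'M_1) 0 0).
Proof.
have e (u1 : 'rV_(kos_rank 2 m)) (u2 : 'rV_(kos_rank 1 m)) :
  ((row_mx u1 u2 : 'rV_(kos_rank 2 m.+1)) *m (kos y m.+1 1 *m kos x m.+1 0) : 'M_1) 0 0 =
    (u1 *m (kos y m 1 *m kos x m 0) : 'M_1) 0 0 +
    (y m * (u2 *m kos x m 0 : 'M_1) 0 0 - x m * (u2 *m kos y m 0 : 'M_1) 0 0).
  have -> : kos y m.+1 1 *m kos x m.+1 0 =
     col_mx (kos y m 1 *m kos x m 0) (y m *: kos x m 0 - x m *: kos y m 0).
    exact: mulmx_cone0.
  rewrite mul_row_col mulmxBr -!scalemxAr.
  by rewrite !mxE.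
split.
  move=> [u ->]; pose u1 := @lsubmx _ 1 (kos_rank 2 m) (kos_rank 1 m) u.
  pose u2 := @rsubmx _ 1 (kos_rank 2 m) (kos_rank 1 m) u.
  rewrite -(@hsubmxK _ 1 (kos_rank 2 m) (kos_rank 1 m) u) e.
  by eexists; split; [exists u1|exists u2].
by move=> [q [[u1 ->]] [u2 ->]]; exists (row_mx u1 u2); rewrite e.
Qed.

Lemma minor_ideal_gen x y m i j : (i < j < m)%N ->
  minor_ideal x y m (x i * y j - x j * y i).
Proof.
elim: m => [|m IHm]; first by rewrite ltn0 andbF.
rewrite ltnS => /andP[ij]; rewrite leq_eqVlt => /orP[/eqP jm|jm]; apply/minor_idealS.
  have [u eu] := kos0_var (leq_trans ij (eq_leq jm)).
  exists 0; split; first by exists 0; rewrite mul0mx mxE.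
  by exists u; rewrite !eu jm add0r mulrC.
exists (x i * y j - x j * y i); split; first by apply: IHm; rewrite ij.
by exists 0; rewrite !mul0mx mxE !mulr0 subrr addr0.
Qed.

Lemma minor_ideal_min x y m (I : A -> Prop) :
    I 0 -> (forall p q, I p -> I q -> I (p + q)) ->
    (forall p q, I q -> I (p * q)) ->
    (forall i j, (i < j < m)%N -> I (x i * y j - x j * y i)) ->
  forall p, minor_ideal x y m p -> I p.
Proof.
move=> I0 ID IM; elim: m => [|m IHm] Ig p.
  by move=> [u ->]; rewrite mulmx0 mulmx0 mxE.
move=> /minor_idealS[q [mq [u ->]]]; apply: (ID) => //.
  by apply: IHm => // i j /andP[ij jm]; apply: Ig; rewrite ij ltnW.
have [c ec] := kos0_sum u; rewrite !ec !mulr_sumr -sumrB.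
apply: big_ind => // i _.
have -> : y m * (c i * x i) - x m * (c i * y i) = c i * (x i * y m - x m * y i) by ring.
by apply/IM/Ig; rewrite ltnSn andbT.
Qed.

Lemma minor_ideal0 x y m : minor_ideal x y m 0.
Proof. by exists 0; rewrite mul0mx mxE. Qed.

Lemma minor_idealD x y m p q :
  minor_ideal x y m p -> minor_ideal x y m q -> minor_ideal x y m (p + q).
Proof. by move=> [u ->] [v ->]; exists (u + v); rewrite mulmxDl [RHS]mxE. Qed.

Lemma minor_idealM x y m p q : minor_ideal x y m q -> minor_ideal x y m (p * q).
Proof. by move=> [u ->]; exists (p *: u); rewrite -scalemxAl [RHS]mxE. Qed.

End MinorIdeal.

(** * The complex as a minimal graded resolution of the ideal of 2-minors *)

Section EagonNorthcottComplex.

Variables (K : fieldType) (N : nat).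
Local Notation S := {mpoly K[N]}.
Variables (a b : nat -> 'I_N) (m : nat).

Local Notation dx := (kos (fun l => 'X_(a l) : S) m).
Local Notation dy := (kos (fun l => 'X_(b l) : S) m).

(* Row p of [c] is the coefficient of u^(p) v^(q) in D_(i+1)(S^2) (x) Lambda^(i+3),
   for p + q = i + 1. *)
Definition en_fun i (c : 'M[S]_(i.+2, kos_rank i.+3 m)) :
    'M[S]_(i.+1, kos_rank i.+2 m) :=
  row' ord0 c *m dx i.+2 + row' ord_max c *m dy i.+2.

Lemma en_fun_is_linear i : linear (@en_fun i).
Proof.
move=> k c c'; rewrite /en_fun !linearP /= !mulmxDl -!scalemxAl scalerDr.
by rewrite !addrA; congr (_ + _); rewrite -!addrA; congr (_ + _); rewrite addrC.
Qed.

HB.instance Definition _ i :=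
  GRing.isLinear.Build S 'M[S]_(i.+2, kos_rank i.+3 m) 'M[S]_(i.+1, kos_rank i.+2 m)
    *:%R (@en_fun i) (@en_fun_is_linear i).

(** For [i > 0], the rank of D_(i-1)(S^2) (x) Lambda^(i+1), whose elements are matrices flattened by
    [mxvec]. *)
Definition en_rank i : nat :=
  if i is i'.+1 then (i * kos_rank i.+1 m)%N else 1%N.

Definition en_deg i (_ : 'I_(en_rank i)) : nat := if i is i'.+1 then i.+1 else 0%N.

Definition en_diff i : 'M[S]_(en_rank i.+1, en_rank i) :=
  match i with
  | 0 => lin_mx (mulmxr (dy 1 *m dx 0) : 'M_(1, kos_rank 2 m) -> 'M_(1, 1))
  | i'.+1 => lin_mx (@en_fun i')
  end.

Definition en_complex : gcomplex K N :=
  @GComplex K N en_rank en_deg en_diff (const_mx 1).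

Lemma row_en_fun i (c : 'M[S]_(i.+2, kos_rank i.+3 m)) p :
  row p (en_fun c) = row (lift ord0 p) c *m dx i.+2 + row (lift ord_max p) c *m dy i.+2.
Proof.
apply/rowP => j; rewrite !mxE.
by congr (_ + _); apply: eq_bigr => l _; rewrite !mxE.
Qed.

(** The two mixed terms involve the same row of [c] and cancel by anticommutation. *)
Lemma en_fun_comp i (c : 'M[S]_(i.+3, kos_rank i.+4 m)) : en_fun (en_fun c) = 0.
Proof.
apply/row_matrixP => p; rewrite row0 !row_en_fun !mulmxDl -!mulmxA dxx dyy.
rewrite !mulmx0 add0r addr0 dxy mulmxN.
rewrite (_ : lift ord_max (lift ord0 p) = lift ord0 (lift ord_max p)) ?subrr //.
  by rewrite addrC subrr.
apply/val_inj; rewrite /= /bump /=; have := ltn_ord p.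
by case: p => p /= pi; lia.
Qed.

Lemma lin_mx_entry m1 n1 m2 n2 (f : {linear 'M[S]_(m1, n1) -> 'M[S]_(m2, n2)})
    i j i' j' :
  lin_mx f (mxvec_index i j) (mxvec_index i' j') = f (delta_mx i j) i' j'.
Proof. by rewrite mxE /= vec_mx_delta mxvecE. Qed.

Definition homog_mx d r c (A : 'M[S]_(r, c)) : Prop := forall i j, A i j \is d.-homog.

Lemma homog_mulmx d e r c l (A : 'M[S]_(r, c)) (B : 'M[S]_(c, l)) :
  homog_mx d A -> homog_mx e B -> homog_mx (d + e) (A *m B).
Proof.
by move=> hA hB i j; rewrite mxE; apply: rpred_sum => k _; apply: dhomogM.
Qed.

Lemma homog_delta_mx r c i j : homog_mx 0 (delta_mx i j : 'M[S]_(r, c)).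
Proof. by move=> i' j'; rewrite mxE; case: (_ && _); rewrite ?dhomog1 ?dhomog0. Qed.

Lemma homog_kos (c : nat -> 'I_N) k : homog_mx 1 (kos (fun l => 'X_(c l) : S) m k).
Proof.
move=> i j; apply/dhomogP => mon /msupp_kos[l _ ->].
exact: mdeg1.
Qed.

Lemma homog_en_diff i : homog_mx (if i is 0 then 2 else 1) (en_diff i).
Proof.
have h1 r k i0 j0 c (p : 'I_r) : homog_mx 1
    (row' p (delta_mx i0 j0) *m kos (fun l => 'X_(c l) : S) m k).
  rewrite -[1%N]add0n; apply: homog_mulmx; last exact: homog_kos.
  by move=> i' j'; rewrite mxE; apply: homog_delta_mx.
case: i => [|i] p q.
  case/(@mxvec_indexP 1 (kos_rank 2 m)): p => p p'.
  case/(@mxvec_indexP 1 1): q => q q'.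
  have -> : en_diff 0 (mxvec_index p p') (@mxvec_index 1 1 q q') =
      (delta_mx p p' *m (dy 1 *m dx 0)) q q'.
    exact: lin_mx_entry (mulmxr (dy 1 *m dx 0) : 'M_(1, kos_rank 2 m) -> 'M_(1, 1)) _ _ _ _.
  apply: (@homog_mulmx 0 2); first exact: homog_delta_mx.
  by apply: (@homog_mulmx 1 1); apply: homog_kos.
case/(@mxvec_indexP i.+2 (kos_rank i.+3 m)): p => p p'.
case/(@mxvec_indexP i.+1 (kos_rank i.+2 m)): q => q q'.
have -> : en_diff i.+1 (mxvec_index p p') (mxvec_index q q') =
    en_fun (delta_mx p p') q q'.
  exact: lin_mx_entry (@en_fun i) _ _ _ _.
by rewrite mxE; apply: dhomogD; apply: h1.
Qed.

Hypothesis a_inj : forall i j, (i < j < m)%N -> a i != a j.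
Hypothesis b_inj : forall i j, (i < j < m)%N -> b i != b j.
Hypothesis ab_neq : forall i j, (i < m)%N -> (j < m)%N -> a i != b j.

Lemma en_fun_aug (c : 'M[S]_(2, kos_rank 3 m)) : en_fun c *m (dy 1 *m dx 0) = 0.
Proof.
rewrite /en_fun mulmxDl -!mulmxA !(mulmxA (dy 2)) dyy mul0mx mulmx0 addr0.
by rewrite !(mulmxA (dx 2)) dxy mulNmx -mulmxA dxx mulmx0 oppr0 mulmx0.
Qed.

Lemma en_fun_lift i (c : 'M[S]_(i.+1, kos_rank i.+2 m)) (v : nat -> 'rV_(kos_rank i.+3 m)) :
    (forall p, (p <= i)%N ->
       row (inord p) c = v p.+1 *m dx i.+2 + v p *m dy i.+2) ->
  c = en_fun (\matrix_(p < i.+2) v p).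
Proof.
move=> cv; apply/row_matrixP => p; rewrite row_en_fun !rowK /= /bump leq0n add1n.
by rewrite leqNgt ltn_ord add0n -cv ?inord_val // -ltnS.
Qed.

(** With a single row there are no cycle relations, and the hypothesis is exactly the corner
    condition. *)
Lemma en_exact0 (c : 'M[S]_(1, kos_rank 2 m)) :
  c *m (dy 1 *m dx 0) = 0 -> exists c', c = en_fun c'.
Proof.
move=> c0; have [||v ev] := @en_exact _ _ a b m a_inj b_inj ab_neq 0 0
    (fun p => row (inord p) c) => //.
  by rewrite -mulmxA -row_mul c0 row0.
by exists (\matrix_p v p); apply: en_fun_lift.
Qed.

Lemma en_exactS i (c : 'M[S]_(i.+2, kos_rank i.+3 m)) :
  en_fun c = 0 -> exists c', c = en_fun c'.
Proof.
move=> c0; pose r p := row (inord p) c.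
have cyc p : (p < i.+1)%N -> r p.+1 *m dx i.+2 + r p *m dy i.+2 = 0.
  move=> pi; have := congr1 (row (Ordinal pi)) c0; rewrite row0 row_en_fun.
  apply: etrans; congr (_ + _); congr (_ *m _); congr row; apply/val_inj => /=;
    by rewrite inordK /bump /=; lia.
(* Here the corner condition follows from the last cycle relation: up to sign, [r i.+1 *m dy *m dx]
   is [r i *m dy *m dy], which is zero. *)
have [|v ev] := @en_exact _ _ a b m a_inj b_inj ab_neq i.+1 i.+1 r cyc.
  rewrite -mulmxA -[dy _ *m _]opprK -dxy mulmxN mulmxA.
  have /eqP := cyc i (ltnSn i); rewrite addr_eq0 => /eqP ->.
  by rewrite mulNmx -mulmxA dyy mulmx0 !oppr0.
by exists (\matrix_p v p); apply: en_fun_lift.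
Qed.

Lemma en_resolution : minimal_graded_free_resolution
  (minor_ideal (fun l => 'X_(a l) : S) (fun l => 'X_(b l)) m) en_complex.
Proof.
split.
- split=> [[|i] p q mon monpq|p]; last by rewrite mxE; apply: dhomog1.
    by have /dhomogP/(_ _ monpq) /= -> := homog_en_diff p q.
  by have /dhomogP/(_ _ monpq) /= -> := homog_en_diff p q; rewrite add1n.
- split.
  + move=> p; exists p%:M.
    rewrite mul_scalar_mx !mxE mulr1 subrr.
    by exists 0; rewrite mul0mx mxE.
  + move=> v; have -> : (v *m gaug en_complex) 0 0 = v 0 0.
      by rewrite mxE big_ord1 [gaug _ _ _]mxE mulr1.
    have ev (c : 'M[S]_(1, kos_rank 2 m)) : (mxvec c *m en_diff 0 : 'rV_1) 0 0 =
        (c *m (dy 1 *m dx 0) : 'M_1) 0 0.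
      have -> : mxvec c *m en_diff 0 = mxvec (c *m (dy 1 *m dx 0) : 'M_(1, 1)).
        exact: mul_vec_lin (mulmxr (dy 1 *m dx 0) : 'M_(1, kos_rank 2 m) -> 'M_(1, 1)) c.
      move: (c *m _ : 'M_(1, 1)) => C.
      rewrite -(mxvecE C 0 0); congr (mxvec C _ _).
      by apply/val_inj; case: (mxvec_index _ _) => -[].
    split.
      move=> [u eu]; exists (mxvec u); apply/rowP => j; rewrite ord1 [LHS]eu.
      exact/esym/ev.
    by move=> [w ->]; exists (vec_mx w); rewrite -ev vec_mxK.
  + have mx0 r c (A : 'M[S]_(r, c)) : mxvec A = 0 -> A = 0.
      by move=> /eqP; rewrite mxvec_eq0 => /eqP.
    move=> [|i] v.
      have e (c : 'M_(1, kos_rank 2 m)) : mxvec c *m gdiff en_complex 0 =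
        mxvec (c *m (dy 1 *m dx 0) : 'M_(1, 1)).
        exact: mul_vec_lin (mulmxr (dy 1 *m dx 0) : 'M_(1, kos_rank 2 m) -> 'M_(1, 1)) c.
      have e' (c : 'M_(2, kos_rank 3 m)) : mxvec c *m gdiff en_complex 1 =
        mxvec (en_fun c) by exact: mul_vec_lin (@en_fun 0) c.
      rewrite -[v](@vec_mxK _ 1 (kos_rank 2 m)) e; move: (vec_mx v) => c; split.
        move=> /(mx0 1%N 1%N)/en_exact0[c' ->].
        by exists (mxvec c'); rewrite e'.
      move=> [w]; rewrite -[w](@vec_mxK _ 2 (kos_rank 3 m)) e' => /(can_inj mxvecK) ->.
      by rewrite en_fun_aug linear0.
    have e j (c : 'M_(j.+2, kos_rank j.+3 m)) : mxvec c *m gdiff en_complex j.+1 =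
      mxvec (en_fun c) by exact: mul_vec_lin (@en_fun j) c.
    rewrite -[v](@vec_mxK _ i.+2 (kos_rank i.+3 m)) e; move: (vec_mx v) => c; split.
      move=> /mx0/en_exactS[c' ->].
      by exists (mxvec c'); rewrite e.
    move=> [w]; rewrite -[w](@vec_mxK _ i.+3 (kos_rank i.+4 m)) e => /(can_inj mxvecK) ->.
    by rewrite en_fun_comp linear0.
- move=> [|i] p q; apply: (dhomog_nemf_coeff (homog_en_diff p q));
    by rewrite /= mdeg0.
Qed.

Lemma nb_gens_en i j : nb_gens en_complex i j =
  (if i is i'.+1 then (j == i.+1) * (i * 'C(m, i.+1)) else j == 0)%N.
Proof.
rewrite nb_gensE; case: i => [|i] /=.
  by rewrite big_ord1 eq_sym.
rewrite sum_nat_const card_ord mulnC eq_sym kos_rankE //.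
Qed.

End EagonNorthcottComplex.

(** * Binomial edge ideals *)

Section Substitution.

Variables (K : fieldType) (N : nat).
Local Notation S := {mpoly K[N]}.

Definition subst (h : 'I_N -> S) : S -> S := mmap (@mpolyC N K) h.

Lemma substD h : {morph subst h : p q / p + q}. Proof. exact: mmapD. Qed.
Lemma subst0 h : subst h 0 = 0. Proof. exact: mmap0. Qed.
Lemma substN h : {morph subst h : p / - p}. Proof. exact: mmapN. Qed.
Lemma substB h : {morph subst h : p q / p - q}. Proof. exact: mmapB. Qed.
Lemma substM h : {morph subst h : p q / p * q}. Proof. exact: rmorphM. Qed.
Lemma substC h c : subst h c%:MP = c%:MP. Proof. exact: mmapC. Qed.
Lemma substZ h c p : subst h (c *: p) = c *: subst h p.
Proof. by rewrite /subst mmapZ mul_mpolyC. Qed.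
Lemma substX h i : subst h 'X_i = h i.
Proof. by rewrite /subst mmapX mmap1U. Qed.
Lemma subst_sum h (I : Type) (r : seq I) (P : pred I) F :
  subst h (\sum_(i <- r | P i) F i) = \sum_(i <- r | P i) subst h (F i).
Proof. exact: raddf_sum. Qed.

Lemma mpoly_gen_ind (P : S -> Prop) :
    (forall c, P c%:MP) -> (forall i, P 'X_i) ->
    (forall p q, P p -> P q -> P (p + q)) ->
    (forall p q, P p -> P q -> P (p * q)) -> forall p, P p.
Proof.
move=> PC PX PD PM p.
have PXm mon : P 'X_[mon].
  rewrite mpolyXE_id; elim/big_ind: _ => //; first by rewrite -mpolyC1.
  move=> i _; elim: (mon i) => [|k IHk]; first by rewrite expr0 -mpolyC1.
  by rewrite exprS; apply: PM.
elim/mpolyind: p => [|c mon p _ _ Pp]; first by rewrite -mpolyC0.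
by apply: PD => //; rewrite -mul_mpolyC; apply: PM.
Qed.

(** The kernel of a monomial map is spanned by binomials. Subtracting a multiple of one of them
    removes the leading monomial of [p], so the induction is on the size of the support. *)
Lemma monomial_map_ker (h : 'I_N -> S) (mu : 'X_{1..N} -> 'X_{1..N})
    (I : S -> Prop) : is_ideal I ->
    (forall mon, subst h 'X_[mon] = 'X_[mu mon]) ->
    (forall x y, mu x = mu y -> I ('X_[x] - 'X_[y])) ->
  forall p, subst h p = 0 -> I p.
Proof.
move=> idI hmu Imu p; have [I0 ID IM] := idI.
have [k] := ubnP (size (msupp p)); elim: k p => // k IHk p; rewrite ltnS => pk p0.
have [->//|/mlead_supp] := eqVneq p 0; set x := mlead p => xp.
(* Otherwise the coefficient of [p] at [x] would survive as that of [subst h p] at [mu x]. *)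
have [y yp /andP[yx /eqP mxy]] : exists2 y, y \in msupp p & (y != x) && (mu y == mu x).
  apply/hasP; apply/negPn/negP => /hasPn H.
  have : (subst h p)@_(mu x) = p@_x.
    rewrite {1}(mpolyE p) subst_sum raddf_sum /= (bigD1_seq x) ?msupp_uniq //=.
    rewrite substZ hmu mcoeffZ mcoeffX eqxx mulr1 big_seq_cond big1 ?addr0 // => y.
    move=> /andP[yp yx]; rewrite substZ hmu mcoeffZ mcoeffX.
    by have := H _ yp; rewrite yx /= => /negPf ->; rewrite mulr0.
  by rewrite p0 mcoeff0 => /esym/eqP; rewrite mcoeff_eq0 xp.
pose q := p - p@_x *: ('X_[x] - 'X_[y]).
have Iq : I q.
  apply: IHk; last by rewrite substB substZ substB !hmu mxy subrr scaler0 subr0.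
  apply: leq_trans pk; rewrite -[size (msupp p)]prednK ?ltnS; last by case: (msupp p) xp.
  rewrite -(size_rem xp); apply: uniq_leq_size => [|z]; first exact: msupp_uniq.
  rewrite mem_rem_uniq ?msupp_uniq // !inE !mcoeff_msupp.
  rewrite mcoeffB mcoeffZ mcoeffB !mcoeffX.
  case: (eqVneq x z) => [<-|xz]; first by rewrite (negPf yx) subr0 mulr1 subrr eqxx.
  rewrite /=; case: (eqVneq y z) => [<- _|_]; first by rewrite -mcoeff_msupp.
  by rewrite subrr mulr0 subr0.
have -> : p = q + (p@_x)%:MP * ('X_[x] - 'X_[y]) by rewrite mul_mpolyC subrK.
by apply: ID => //; apply/IM/Imu.
Qed.

End Substitution.

(** * Generators and homogeneity of binomial edge ideals *)

Section BinomialEdgeIdeal.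

Variables (K : fieldType) (n : nat).
Local Notation S := {mpoly K[n + n]}.
Implicit Types (e : rel 'I_n) (u v w i j : 'I_n) (p q : S).

Local Notation J e := (binomial_edge_ideal (K := K) e).

Definition edge_binomial i j : S := xvar K i * yvar K j - xvar K j * yvar K i.
Local Notation f := edge_binomial.

Lemma edge_binomialC i j : f i j = - f j i.
Proof. by rewrite /f opprB. Qed.

Lemma edge_binomial_id i : f i i = 0.
Proof. by rewrite /f subrr. Qed.

Lemma bei_ideal e : is_ideal (J e).
Proof.
split.
- by exists (fun _ _ => 0); rewrite big1 // => i _; rewrite big1 // => j _; rewrite mul0r.
- move=> _ _ [c ->] [d ->]; exists (fun i j => c i j + d i j).
  rewrite -big_split; apply: eq_bigr => i _; rewrite -big_split; apply: eq_bigr => j _.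
  by rewrite mulrDl.
- move=> p _ [c ->]; exists (fun i j => p * c i j).
  rewrite mulr_sumr; apply: eq_bigr => i _; rewrite mulr_sumr; apply: eq_bigr => j _.
  by rewrite mulrA.
Qed.

Lemma bei_ind e (P : S -> Prop) : P 0 -> (forall p q, P p -> P q -> P (p + q)) ->
  (forall c i j, (i < j)%N -> e i j -> P (c * f i j)) -> forall p, J e p -> P p.
Proof.
move=> P0 PD Pf _ [c ->]; apply: big_ind => // i _.
by apply: big_ind => // j /andP[ij eij]; apply: Pf.
Qed.

Lemma bei_gen_lt e i j : (i < j)%N -> e i j -> J e (f i j).
Proof.
move=> ij eij; exists (fun k l => ((k == i) && (l == j))%:R).
rewrite (bigD1 i) //= (bigD1 j) ?ij //= !eqxx mul1r !big1 ?addr0 //.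
  by move=> k /negPf ->; rewrite big1 // => l _; rewrite mul0r.
by move=> l /andP[_ /negPf->]; rewrite mul0r.
Qed.

Lemma bei_gen e i j : ssrbool.symmetric e -> e i j -> J e (f i j).
Proof.
move=> se; case: (ltngtP i j) => [ij|ij|/val_inj->] eij; first exact: bei_gen_lt.
  rewrite edge_binomialC; apply: (idealN (bei_ideal e)).
  by apply: bei_gen_lt; rewrite // se.
by rewrite edge_binomial_id; case: (bei_ideal e).
Qed.

Lemma bei_sub e e' : ssrbool.symmetric e' -> subrel e e' -> forall p, J e p -> J e' p.
Proof.
move=> se' ee'; have [J0 JD JM] := bei_ideal e'; apply: bei_ind => // c i j _ eij.
by apply/JM/bei_gen => //; apply: ee'.
Qed.

Lemma edge_binomial_homog i j : f i j \is 2.-homog.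
Proof.
have h (k l : 'I_(n + n)) : ('X_k * 'X_l : S) \is 2.-homog.
  by apply: (@dhomogM _ _ _ 1%N _ 1%N); rewrite dhomogX /= mdeg1.
by rewrite /f; apply: rpredB; apply: h.
Qed.

Lemma bei_graded e : is_graded (J e).
Proof.
move=> d p Jp; have [J0 JD JM] := bei_ideal e.
move: p Jp; apply: bei_ind.
- by rewrite restr0.
- by move=> p q; rewrite restrD; apply: JD.
move=> c i j ij eij.
rewrite (restrM (Q' := fun mon => mdeg mon + 2 == d)%N) => [|x y].
  by apply/JM/bei_gen_lt.
by move/dhomogP: (edge_binomial_homog i j) => h /h /= <-; rewrite mdegD.
Qed.

End BinomialEdgeIdeal.

Lemma eq_of_leq_sum (I : finType) (P : pred I) (x y : I -> nat) :
    (\sum_(i | P i) x i = \sum_(i | P i) y i)%N ->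
    (forall i, P i -> (x i <= y i)%N) ->
  forall i, P i -> x i = y i.
Proof.
move=> exy xy i Pi; move: exy; rewrite (bigD1 i) //= [RHS](bigD1 i) //= => exy.
have : (\sum_(j | P j && (j != i)) x j <= \sum_(j | P j && (j != i)) y j)%N.
  by apply: leq_sum => j /andP[Pj _]; apply: xy.
by have := xy i Pi; lia.
Qed.

(** * Graphs all of whose vertices are free *)

Section DisjointCliques.

Variables (K : fieldType) (n : nat).
Local Notation S := {mpoly K[n + n]}.
Local Notation J e := (binomial_edge_ideal (K := K) e).
Local Notation f := (edge_binomial K).
Local Notation l := (@lshift n n).
Local Notation r := (@rshift n n).

Definition free_vertex (e : rel 'I_n) v :=
  [forall i, forall j, [&& e v i, e v j & i != j] ==> e i j].

Lemma free_vertexP (e : rel 'I_n) v :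
  reflect (forall i j, e v i -> e v j -> i != j -> e i j) (free_vertex e v).
Proof.
apply: (iffP forallP) => [h i j vi vj ij|h i].
  by have /forallP/(_ j) := h i; rewrite vi vj ij.
by apply/forallP => j; apply/implyP => /and3P[]; apply: h.
Qed.

Variable e : rel 'I_n.
Hypotheses (e_sym : ssrbool.symmetric e) (e_free : forall v, free_vertex e v).

Definition same_clique i j := (i == j) || e i j.

Lemma same_clique_trans i j k : same_clique i j -> same_clique i k -> same_clique j k.
Proof.
rewrite /same_clique => /predU1P[<-//|ij] /predU1P[<-|ik].
  by rewrite e_sym ij orbT.
have [//|jk] := eqVneq j k; exact: (free_vertexP _ _ (e_free i)).
Qed.

Lemma same_cliqueC i j : same_clique i j = same_clique j i.
Proof. by rewrite /same_clique eq_sym e_sym. Qed.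

(** [pick] returns the same vertex for extensionally equal predicates, hence one representative per
    clique; the default is never reached, as [i] itself qualifies. *)
Definition clique_repr i : 'I_n := odflt i [pick j | same_clique i j].
Local Notation c := clique_repr.

Lemma clique_repr_same i : same_clique i (c i).
Proof.
by rewrite /clique_repr; case: pickP => //= _; rewrite /same_clique eqxx.
Qed.

Lemma clique_repr_eq i j : same_clique i j -> c i = c j.
Proof.
move=> ij; have e1 : same_clique i =1 same_clique j.
  move=> k; apply/idP/idP; first exact: same_clique_trans.
  by apply: same_clique_trans; rewrite same_cliqueC.
rewrite /clique_repr (eq_pick e1); case: pickP => // h.
by have := h j; rewrite /same_clique eqxx.
Qed.

Lemma eq_clique_repr i j : c i = c j -> same_clique i j.
Proof.
move=> cij; have := clique_repr_same j; rewrite -cij same_cliqueC.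
by apply: same_clique_trans; rewrite same_cliqueC; apply: clique_repr_same.
Qed.

(* The parametrization x_i |-> x_i, y_i |-> x_i y_(c i). *)
Definition clique_var (i : 'I_(n + n)) : 'X_{1..n + n} :=
  match split i with
  | inl i => U_(l i)
  | inr i => U_(l i) + U_(r (c i))
  end%MM.

Lemma clique_varl i : clique_var (l i) = U_(l i)%MM.
Proof. by rewrite /clique_var (unsplitK (inl i)). Qed.

Lemma clique_varr i : clique_var (r i) = (U_(l i) + U_(r (c i)))%MM.
Proof. by rewrite /clique_var (unsplitK (inr i)). Qed.

Definition clique_mnm (mon : 'X_{1..n + n}) : 'X_{1..n + n} :=
  (\sum_i (clique_var i *+ mon i))%MM.

Lemma subst_clique mon :
  subst (fun i => 'X_[clique_var i] : S) 'X_[mon] = 'X_[clique_mnm mon].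
Proof. by rewrite /subst mmapX /mmap1 mprodXnE. Qed.

Lemma clique_mnmD x y : clique_mnm (x + y)%MM = (clique_mnm x + clique_mnm y)%MM.
Proof.
apply/mnmP => i; rewrite /clique_mnm mnmDE !mnm_sumE -big_split; apply: eq_bigr => j _.
by rewrite !mulmnE mnmDE mulnDr.
Qed.

Lemma clique_mnmU i : clique_mnm U_(i)%MM = clique_var i.
Proof.
apply/mnmP => j; rewrite /clique_mnm mnm_sumE (bigD1 i) //= mulmnE mnm1E eqxx muln1.
by rewrite big1 ?addn0 // => k ki; rewrite mulmnE mnm1E eq_sym (negPf ki) muln0.
Qed.

Lemma clique_mnml mon i : clique_mnm mon (l i) = (mon (l i) + mon (r i))%N.
Proof.
rewrite /clique_mnm mnm_sumE big_split_ord /=; congr addn.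
  rewrite (bigD1 i) //= mulmnE clique_varl mnm1E eqxx mul1n.
  rewrite big1 ?addn0 // => k ki; rewrite mulmnE clique_varl mnm1E.
  by rewrite (inj_eq (@lshift_inj _ _)) (negPf ki).
rewrite (bigD1 i) //= mulmnE clique_varr mnmDE !mnm1E eqxx eq_rlshift mul1n.
rewrite big1 ?addn0 // => k ki; rewrite mulmnE clique_varr mnmDE !mnm1E.
by rewrite (inj_eq (@lshift_inj _ _)) (negPf ki) eq_rlshift.
Qed.

Lemma clique_mnmr mon k :
  clique_mnm mon (r k) = (\sum_(i | c i == k) mon (r i))%N.
Proof.
rewrite /clique_mnm mnm_sumE big_split_ord /= big1 ?add0n => [|i _].
  rewrite [RHS]big_mkcond; apply: eq_bigr => i _.
  rewrite mulmnE clique_varr mnmDE !mnm1E eq_lrshift add0n.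
  by rewrite (inj_eq (@rshift_inj _ _)); case: eqP; rewrite ?mul1n.
by rewrite mulmnE clique_varl mnm1E eq_lrshift.
Qed.

(** Inside a clique, trading y_i x_j for x_i y_j changes a monomial by a multiple of an edge
    binomial. Suitable trades lower the total excess of the y-exponents of [x] over those of [y]. *)
Lemma clique_mnm_congr x y : clique_mnm x = clique_mnm y -> J e ('X_[x] - 'X_[y]).
Proof.
have [J0 JD JM] := bei_ideal K e.
have [d] := ubnP (\sum_i (x (r i) - y (r i)))%N; elim: d x => // d IHd x.
rewrite ltnS => xd exy.
have exl i : (x (l i) + x (r i) = y (l i) + y (r i))%N.
  by rewrite -!clique_mnml exy.
have exr k : (\sum_(i | c i == k) x (r i) = \sum_(i | c i == k) y (r i))%N.
  by rewrite -!clique_mnmr exy.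
case: (pickP (fun i => y (r i) < x (r i))%N) => [i yxi|le_xy]; last first.
  have xy i : x (r i) = y (r i).
    apply: (eq_of_leq_sum (exr (c i))) => // j _.
    by have := le_xy j; lia.
  suff -> : x = y by rewrite subrr.
  apply/mnmP => k; case: (split_ordP k) => i ->; last exact: xy.
  by have := exl i; rewrite xy; lia.
(* The y-exponents have equal sums over each clique, so an excess at [i] forces a deficit at some
   [j] in its clique. *)
have [j /eqP cij xyj] : exists2 j, c j == c i & (x (r j) < y (r j))%N.
  have [/existsP[j /andP[cj xyj]]|/existsPn H] :=
    boolP [exists j, (c j == c i) && (x (r j) < y (r j))%N]; first by exists j.
  have E := eq_of_leq_sum (esym (exr (c i))) _ (eqxx (c i)).
  move: yxi; rewrite E ?ltnn // => j cj.
  by have := H j; rewrite cj /= -leqNgt.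
have ji : j != i by apply: contraTneq xyj => ->; rewrite -leqNgt ltnW.
have xj : (0 < x (l j))%N by have := exl j; lia.
pose z := (x - U_(r i) - U_(l j))%MM.
have ex : x = (z + (U_(r i) + U_(l j)))%MM.
  apply/mnmP => k; rewrite !mnmDE !mnmBE !mnm1E.
  case: (eqVneq (r i) k) => [<-|_]; first by rewrite eq_lrshift; lia.
  by case: (eqVneq (l j) k) => [<-|_]; lia.
pose x' := (z + (U_(l i) + U_(r j)))%MM.
have Jxx : J e ('X_[x] - 'X_[x']).
  have -> : 'X_[x] - 'X_[x'] = 'X_[z] * f j i.
    by rewrite ex /x' !mpolyXD /f /xvar /yvar; ring.
  apply/JM/bei_gen => //; have := eq_clique_repr cij.
  by rewrite /same_clique (negPf ji).
have -> : 'X_[x] - 'X_[y] = ('X_[x] - 'X_[x']) + ('X_[x'] - 'X_[y]) :> S.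
  by rewrite addrA subrK.
apply: JD => //; apply: IHd; last first.
  rewrite -exy ex /x' !clique_mnmD !clique_mnmU !clique_varl !clique_varr cij.
  by apply/mnmP => k; rewrite !mnmDE; lia.
apply: leq_trans xd; rewrite [X in (_ < X)%N](bigD1 i) //= [X in (X < _)%N](bigD1 i) //=.
have x'r k : x' (r k) = (x (r k) - (i == k) + (j == k))%N.
  rewrite /x' /z !mnmDE !mnmBE !mnm1E !eq_lrshift !(inj_eq (@rshift_inj _ _)).
  by rewrite subn0 add0n.
rewrite -addSn; apply: leq_add.
  by rewrite x'r eqxx (negPf ji); lia.
apply: leq_sum => k ki; rewrite x'r eq_sym (negPf ki).
by case: eqVneq => [<-|_]; lia.
Qed.

(** The parametrization maps to a domain and its kernel is the ideal; [f v w] goes to x_v x_w (y_(c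
    w) - y_(c v)), nonzero because [w] forms a clique alone. *)
Lemma edge_binomial_regular_cliques v w p : v != w -> (forall i, ~~ e w i) ->
  J e (f v w * p) -> J e p.
Proof.
move=> vw ew Jp.
pose phi := subst (fun i => 'X_[clique_var i] : S).
have phiJ q : J e q -> phi q = 0.
  move: q; apply: bei_ind => [|q q' e1 e2|q i j _ eij].
  - exact: raddf0.
  - by rewrite /phi substD [subst _ q]e1 [subst _ q']e2 addr0.
  rewrite /phi substM substB !substM /xvar /yvar !substX !clique_varl !clique_varr.
  rewrite (@clique_repr_eq i j) /same_clique ?eij ?orbT // !mpolyXD.
  by rewrite [X in _ - X]mulrCA subrr mulr0.
apply: (monomial_map_ker (bei_ideal K e) subst_clique clique_mnm_congr).
have cvw : c w != c v.
  apply/eqP => /eq_clique_repr; rewrite /same_clique (negPf (ew v)) orbF eq_sym.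
  by rewrite (negPf vw).
have /eqP := phiJ _ Jp; rewrite /phi substM mulf_eq0 => /orP[|/eqP //].
rewrite substB !substM /xvar /yvar !substX !clique_varl !clique_varr !mpolyXD.
rewrite [X in _ - X]mulrCA -!mulrBr !mulf_eq0 => H; exfalso; move: H.
have XU0 (i : 'I_(n + n)) : 'X_i != 0 :> S.
  apply/eqP => /(congr1 (mcoeff U_(i))); rewrite mcoeffX eqxx mcoeff0 => /eqP.
  by rewrite oner_eq0.
rewrite !(negPf (XU0 _)) /= subr_eq0 => /eqP/(congr1 (mcoeff U_(r (c w)))).
rewrite !mcoeffX eqxx eq_mnm1 (inj_eq (@rshift_inj _ _)) eq_sym (negPf cvw) => /eqP.
by rewrite oner_eq0.
Qed.

End DisjointCliques.

(** * Ohtani's decomposition and regularity of edge binomials at a free vertex *)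

Section FreeVertex.

Variables (K : fieldType) (n : nat).
Local Notation S := {mpoly K[n + n]}.
Local Notation J e := (binomial_edge_ideal (K := K) e).
Local Notation f := (edge_binomial K).
Local Notation l := (@lshift n n).
Local Notation r := (@rshift n n).
Implicit Types e : rel 'I_n.

Definition complete_at e u : rel 'I_n :=
  fun i j => e i j || [&& e u i, e u j & i != j].

Definition isolate e u : rel 'I_n := fun i j => [&& e i j, i != u & j != u].

Definition kill_vertex u : 'I_(n + n) -> S :=
  fun k => if (k == l u) || (k == r u) then 0 else 'X_k.

Lemma kill_edge_binomial u i j : i != u -> j != u ->
  subst (kill_vertex u) (f i j) = f i j.
Proof.
move=> iu ju; rewrite substB !substM /xvar /yvar !substX /kill_vertex.
rewrite !(inj_eq (@lshift_inj _ _)) !(inj_eq (@rshift_inj _ _)) !eq_lrshift !eq_rlshift.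
by rewrite (negPf iu) (negPf ju).
Qed.

Section AtVertex.

Variables (e : rel 'I_n) (u : 'I_n).
Hypotheses (e_sym : ssrbool.symmetric e) (e_irr : irreflexive e).

Lemma complete_at_sym : ssrbool.symmetric (complete_at e u).
Proof. by move=> i j; rewrite /complete_at e_sym [j == i]eq_sym andbCA. Qed.

Lemma complete_at_irr : irreflexive (complete_at e u).
Proof. by move=> i; rewrite /complete_at e_irr eqxx !andbF. Qed.

Lemma isolate_sym : ssrbool.symmetric (isolate e u).
Proof. by move=> i j; rewrite /isolate e_sym [(j != u) && _]andbC. Qed.

Lemma isolate_irr : irreflexive (isolate e u).
Proof. by move=> i; rewrite /isolate e_irr. Qed.

Lemma isolate_free v : free_vertex e v -> free_vertex (isolate e u) v.
Proof.
move=> /free_vertexP fv; apply/free_vertexP => i j /and3P[vi _ iu] /and3P[vj _ ju] ij.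
by rewrite /isolate fv // iu ju.
Qed.

Lemma isolate_free_self : free_vertex (isolate e u) u.
Proof. by apply/free_vertexP => i j; rewrite /isolate eqxx /= andbF. Qed.

Lemma complete_at_free_self : free_vertex (complete_at e u) u.
Proof.
apply/free_vertexP => i j; rewrite /complete_at e_irr /= !orbF => -> -> ->.
by rewrite orbT.
Qed.

(** If [v] is not adjacent to [u], its neighbours are unchanged. Otherwise freeness of [v] puts all
    its neighbours in the closed neighbourhood of [u], which is now a clique. *)
Lemma complete_at_free v : free_vertex e v -> free_vertex (complete_at e u) v.
Proof.
move=> /free_vertexP fv; apply/free_vertexP => i j; rewrite /complete_at.
case: (boolP (e u v)) => [uv|uNv] /=; last by rewrite !orbF => vi vj /(fv _ _ vi vj) ->.
have [->|iu] := eqVneq i u; have [->|ju] := eqVneq j u; rewrite ?eqxx //.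
- move=> _ /orP[vj _|/andP[-> _ //]].
  by rewrite fv // 1?e_sym // eq_sym.
- move=> /orP[vi|/andP[ui _]] _ _; last by rewrite e_sym ui.
  by rewrite fv // e_sym.
- move=> H1 H2 ij.
  have ei k : k != u -> e v k || (e u k && (v != k)) -> e u k.
    by move=> ku /orP[vk|/andP[]//]; rewrite fv // 1?e_sym // eq_sym.
  by rewrite ij (ei _ iu H1) (ei _ ju H2) orbT.
Qed.

Lemma kill_bei p : J e p -> J (isolate e u) (subst (kill_vertex u) p).
Proof.
have [J0 JD JM] := bei_ideal K (isolate e u).
move: p; apply: bei_ind => [|p q|p i j _ eij].
- by rewrite subst0.
- by rewrite substD; apply: JD.
rewrite substM; apply: JM.
have kill0 k : subst (kill_vertex u) (f u k) = 0.
  rewrite substB !substM /xvar /yvar !substX /kill_vertex !eqxx orbT.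
  by rewrite mul0r mulr0 subrr.
have [->|iu] := eqVneq i u; first by rewrite kill0.
have [->|ju] := eqVneq j u; first by rewrite edge_binomialC substN kill0 oppr0.
rewrite kill_edge_binomial //; apply: bei_gen; first exact: isolate_sym.
by rewrite /isolate eij iu.
Qed.

(** The first factor lies in (x_u, y_u), and x_u f_ij = x_i f_uj - x_j f_ui, likewise for y_u,
    brings the product back into the ideal of [e]. *)
Lemma vertex_mul_completion p i j : e u i -> e u j ->
  J e ((p - subst (kill_vertex u) p) * f i j).
Proof.
have [J0 JD JM] := bei_ideal K e; move=> ui uj; move: p; apply: mpoly_gen_ind.
- by move=> c; rewrite substC subrr mul0r.
- move=> k; rewrite substX /kill_vertex; case: eqVneq => [->|_] /=.
    have -> : ('X_(l u) - 0) * f i j = xvar K i * f u j - xvar K j * f u i.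
      by rewrite /f /xvar /yvar; ring.
    by apply: (idealB (bei_ideal K e)); apply/JM/bei_gen.
  case: eqVneq => [->|_]; last by rewrite subrr mul0r.
  have -> : ('X_(r u) - 0) * f i j = yvar K i * f u j - yvar K j * f u i.
    by rewrite /f /xvar /yvar; ring.
  by apply: (idealB (bei_ideal K e)); apply/JM/bei_gen.
- by move=> p q Jp Jq; rewrite substD opprD addrACA mulrDl; apply: JD.
- move=> p q Jp Jq; rewrite substM.
  set p' := subst _ p in Jp *; set q' := subst _ q in Jq *.
  have -> : (p * q - p' * q') * f i j = q * ((p - p') * f i j) + p' * ((q - q') * f i j).
    by ring.
  by apply: JD; apply: JM.
Qed.

(* Ohtani: J_e is the intersection of J_(complete_at e u) and
   (x_u, y_u) + J_(isolate e u). *)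
Lemma bei_intersection p :
    J (complete_at e u) p -> J (isolate e u) (subst (kill_vertex u) p) -> J e p.
Proof.
have idJ := bei_ideal K e; have [J0 JD JM] := idJ; move=> Jp Jkp.
have sub q : J (isolate e u) q -> J e q.
  by apply: bei_sub => // i j /and3P[].
rewrite -[p](subrK (subst (kill_vertex u) p)); apply: (JD) (sub _ Jkp).
move: p Jp {Jkp}; apply: bei_ind.
- by rewrite subst0 subrr.
- by move=> p q Jp Jq; rewrite substD opprD addrACA; apply: JD.
move=> c i j _ /orP[eij|/and3P[ui uj ij]].
  have Jc : J e (c * f i j) by apply/JM/bei_gen.
  by apply: (idealB idJ) => //; apply/sub/kill_bei.
rewrite substM kill_edge_binomial -?mulrBl; first exact: vertex_mul_completion.
  by apply: contraTneq ui => ->; rewrite e_irr.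
by apply: contraTneq uj => ->; rewrite e_irr.
Qed.

End AtVertex.

(** Induction on the number of non-free vertices: both graphs of the decomposition at a non-free [u]
    have fewer. As [v] and [w] are free, they differ from [u], so [f v w] survives setting x_u and
    y_u to 0. *)
Lemma edge_binomial_regular e v w p :
    ssrbool.symmetric e -> irreflexive e -> free_vertex e v ->
    v != w -> (forall i, ~~ e w i) ->
  J e (f v w * p) -> J e p.
Proof.
have [k] := ubnP #|[set u | ~~ free_vertex e u]|.
elim: k e p => // k IHk e p; rewrite ltnS => ek se ie fv vw ew Jp.
have [/existsP[u uNf]|/existsPn allf] := boolP [exists u, ~~ free_vertex e u]; last first.
  apply: (edge_binomial_regular_cliques se) Jp => // u.
  by have := allf u; rewrite negbK.
have fw : free_vertex e w by apply/free_vertexP => i j; rewrite (negPf (ew i)).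
have vu : v != u by apply: contraNneq uNf => <-.
have wu : w != u by apply: contraNneq uNf => <-.
have smaller e' : (forall x, free_vertex e x -> free_vertex e' x) ->
    free_vertex e' u -> (#|[set x | ~~ free_vertex e' x]| < k)%N.
  move=> ee' fu; apply: leq_trans ek; apply: proper_card; apply/properP; split.
    by apply/subsetP => x; rewrite !inE; apply: contra; apply: ee'.
  by exists u; rewrite !inE ?fu.
apply: (bei_intersection (u := u)) => //.
  apply: IHk => //.
  - by apply: smaller => [x|]; [apply: complete_at_free|apply: complete_at_free_self].
  - exact: complete_at_sym.
  - exact: complete_at_irr.
  - exact: complete_at_free.
  - by move=> i; rewrite /complete_at (negPf (ew i)) se (negPf (ew u)).
  - by apply: bei_sub Jp => [|i j ij]; [exact: complete_at_sym|rewrite /complete_at ij].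
apply: IHk => //.
- by apply: smaller => [x|]; [apply: isolate_free|apply: isolate_free_self].
- exact: isolate_sym.
- exact: isolate_irr.
- exact: isolate_free.
- by move=> i; rewrite /isolate (negPf (ew i)).
by have := kill_bei u se Jp; rewrite substM kill_edge_binomial.
Qed.

End FreeVertex.

(** * Lollipops *)

Lemma resolution_iff (K : fieldType) N (I I' : {mpoly K[N]} -> Prop) F :
    (forall p, I p <-> I' p) ->
  minimal_graded_free_resolution I F -> minimal_graded_free_resolution I' F.
Proof.
move=> II' [h [s ex0 ex] m]; split=> //; split=> // [p|v].
  by have [v Iv] := s p; exists v; apply/II'.
by rewrite -II'.
Qed.

Lemma bei_add_edge (K : fieldType) n (e e' : rel 'I_n) v w :
    ssrbool.symmetric e' ->
    (forall i j, e' i j =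
       [|| e i j, (i == v) && (j == w) | (i == w) && (j == v)]) ->
  forall p, binomial_edge_ideal (K := K) e' p <->
    exists q, binomial_edge_ideal e (p - edge_binomial K v w * q).
Proof.
move=> se' e'E p; have [J0 JD JM] := bei_ideal K e; have [J0' JD' JM'] := bei_ideal K e'.
split.
  move: p; apply: bei_ind.
  - by exists 0; rewrite mulr0 subrr.
  - move=> p p' [q Jq] [q' Jq']; exists (q + q').
    by rewrite mulrDr opprD addrACA; apply: JD.
  move=> c i j ij; rewrite e'E => /or3P[eij|/andP[/eqP-> /eqP->]|/andP[/eqP-> /eqP->]].
  - by exists 0; rewrite mulr0 subr0; apply/JM/bei_gen_lt.
  - by exists c; rewrite mulrC subrr.
  - by exists (- c); rewrite (edge_binomialC K w v) !mulrN opprK mulrC addNr.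
move=> [q Jq]; rewrite -[p](subrK (edge_binomial K v w * q)); apply: JD'.
  by apply: bei_sub Jq => // i j eij; rewrite e'E eij.
by rewrite mulrC; apply/JM'/bei_gen => //; rewrite e'E !eqxx orbT.
Qed.

(* The coefficient of s^i z^j in
   (1 + \sum_(b > 0) b 'C(m, b + 1) s^b z^(b + 1)) (1 + s z^2)^t. *)
Definition lollipop_betti m t i j : nat :=
  ((j == i.*2) * 'C(t, i) +
   (i < j <= i.*2) * ((i.*2.+1 - j) * 'C(m, i.*2.+2 - j) * 'C(t, j - i.+1)))%N.

Lemma lollipop_betti_i0 m t j : lollipop_betti m t 0 j = (j == 0)%N.
Proof. by rewrite /lollipop_betti double0 leqn0 bin0 muln1; case: j. Qed.

Lemma lollipop_betti_t0 m i j :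
  lollipop_betti m 0 i.+1 j = ((j == i.+2) * (i.+1 * 'C(m, i.+2)))%N.
Proof.
rewrite /lollipop_betti bin0n muln0 add0n.
have [->|ji] := eqVneq j i.+2.
  rewrite subnn bin0 muln1 ltnSn doubleS /=.
  have -> : (i.+2 <= i.*2.+2)%N by rewrite -!muln2; lia.
  by rewrite !mul1n; congr (_ * 'C(_, _))%N; rewrite -!muln2; lia.
rewrite mul0n; case: (ltnP i.+1 j) => //= ij; rewrite bin0n.
by rewrite (_ : (j - i.+2 == 0)%N = false) ?muln0 //; lia.
Qed.

(** Multiplication of the series by one more factor 1 + s z^2, by Pascal's rule in [t]. *)
Lemma lollipop_bettiS m t i j : lollipop_betti m t.+1 i.+1 j =
  (lollipop_betti m t i.+1 j + if 2 <= j then lollipop_betti m t i (j - 2) else 0)%N.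
Proof.
rewrite /lollipop_betti doubleS; case: (ltnP 1 j) => [j2|j1]; last first.
  rewrite addn0 (_ : (j == i.*2.+2)%N = false) ?mul0n; last by lia.
  by rewrite (_ : (i.+1 < j)%N = false) ?mul0n //; lia.
case: j j2 => [|[|j]] // _; rewrite !subSS subn0 !eqSS binS ltnS.
rewrite (ltnS i j) leq_eqVlt; have [->|ij] := eqVneq i j.
  by rewrite subnn !bin0 ltnn; lia.
case: (ltnP i j) => /= [{}ij|ji]; last first.
  by rewrite (_ : (j == i.*2) = false) ?mul0n //; apply/eqP; rewrite -muln2; lia.
rewrite (_ : (j - i = (j - i.+1).+1)%N); last by lia.
rewrite binS !mulnDr; lia.
Qed.

(** * Building the lollipop one handle vertex at a time *)

Section Lollipop.

Variables (K : fieldType) (m k n : nat) (ts : 'I_k -> nat).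
Variables (v : 'I_k -> 'I_m) (g : 'I_n -> lollipop_vertex m ts).
Variable (h : lollipop_vertex m ts -> 'I_n).
Hypotheses (v_inj : injective v) (hK : cancel h g) (gK : cancel g h).

Local Notation handle_vertex := {i : 'I_k & 'I_(ts i)}.
Implicit Types (Q : {set handle_vertex}) (q : handle_vertex).

Lemma handle_vertex_eq q q' : tag q = tag q' -> tagged q = tagged q' :> nat -> q = q'.
Proof.
case: q q' => i a [j b] /= ij; case: j / ij b => b ab.
by congr Tagged; apply: val_inj.
Qed.

Definition kept Q (a : lollipop_vertex m ts) : bool :=
  if a is inr q then q \in Q else true.

(** Handle vertices outside [Q] remain as isolated vertices, so that all intermediate ideals live in
    one polynomial ring. *)
Definition sub_adj Q : rel (lollipop_vertex m ts) :=
  fun a b => [&& kept Q a, kept Q b & lollipop_adj v a b].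

Definition sub_lollipop Q : rel 'I_n := fun i j => sub_adj Q (g i) (g j).

Lemma lollipop_adj_sym : ssrbool.symmetric (lollipop_adj (t := ts) v).
Proof.
move=> [a|p] [b|q] //=; first by rewrite eq_sym.
by rewrite [tag q == _]eq_sym orbC.
Qed.

Lemma lollipop_adj_irr : irreflexive (lollipop_adj (t := ts) v).
Proof. by move=> [a|p] /=; rewrite ?eqxx //= orbb gtn_eqF. Qed.

Lemma sub_lollipop_sym Q : ssrbool.symmetric (sub_lollipop Q).
Proof. by move=> i j; rewrite /sub_lollipop /sub_adj lollipop_adj_sym andbCA. Qed.

Lemma sub_lollipop_irr Q : irreflexive (sub_lollipop Q).
Proof. by move=> i; rewrite /sub_lollipop /sub_adj lollipop_adj_irr !andbF. Qed.

(** [Q] meets each handle in an initial segment, counted from the clique. *)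
Definition down_closed Q : Prop := forall q q', q' \in Q -> tag q = tag q' ->
  (tagged q < tagged q')%N -> q \in Q.

Definition parent_of q (a : lollipop_vertex m ts) : bool :=
  match a with
  | inl c => (c == v (tag q)) && (tagged q == 0 :> nat)%N
  | inr q' => (tag q' == tag q) && ((tagged q').+1 == tagged q)
  end.

Lemma parent_ex q : exists a, parent_of q a.
Proof.
case eq: (nat_of_ord (tagged q)) => [|p].
  by exists (inl (v (tag q))); rewrite /= eq !eqxx.
have lt_p : (p < ts (tag q))%N by rewrite ltnW // -eq.
by exists (inr (Tagged (fun i => 'I_(ts i)) (Ordinal lt_p))); rewrite /= eq !eqxx.
Qed.

Lemma parent_uniq q a b : parent_of q a -> parent_of q b -> a = b.
Proof.
case: a b => [c|p] [c'|p'] /= /andP[/eqP e1 /eqP e2] /andP[/eqP e3 /eqP e4].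
- by rewrite e1 e3.
- by rewrite e2 in e4.
- by rewrite e4 in e2.
congr inr; apply: handle_vertex_eq; first by rewrite e1.
by apply: succn_inj; rewrite e2.
Qed.

Section RemoveLeaf.

Variables (Q : {set handle_vertex}) (q : handle_vertex) (a : lollipop_vertex m ts).
Hypotheses (downQ : down_closed Q) (qQ : q \in Q) (aq : parent_of q a).
Hypothesis qmax : forall q', q' \in Q -> (tagged q' <= tagged q)%N.

Lemma leaf_adj b : kept Q b -> lollipop_adj v (inr q) b = parent_of q b.
Proof.
case: b => [c|q'] //= q'Q; rewrite [tag q == _]eq_sym; case: eqP => //= _.
rewrite orbC; case: eqP => //= _.
by apply/eqP => e; have := qmax q'Q; rewrite -e ltnn.
Qed.

Lemma parent_kept : kept Q a.
Proof.
case: a aq => //= q' /andP[/eqP tq /eqP eq].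
by apply: (downQ qQ) => //; rewrite -eq.
Qed.

Lemma parent_neq : a != inr q.
Proof.
by apply: contraTneq aq => -> /=; rewrite eqxx gtn_eqF.
Qed.

Lemma sub_adj_remove b c : sub_adj Q b c =
  [|| sub_adj (Q :\ q) b c, (b == a) && (c == inr q) | (b == inr q) && (c == a)].
Proof.
have keptD d : kept (Q :\ q) d = (d != inr q) && kept Q d.
  by case: d => // q' /=; rewrite !inE.
rewrite /sub_adj !keptD.
have kq : kept Q (inr q) by [].
have adjq d : kept Q d && lollipop_adj v (inr q) d = (d == a).
  apply/andP/eqP => [[kd]|->]; last by rewrite parent_kept leaf_adj ?parent_kept.
  by rewrite leaf_adj // => /parent_uniq; apply.
have [->|bq] := eqVneq b (inr q).
  rewrite kq adjq [inr q == a]eq_sym (negPf parent_neq) /=.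
  by [].
have [->|cq] := eqVneq c (inr q); last by rewrite /= !andbF !orbF.
rewrite kq lollipop_adj_sym /= adjq andbF /= andbT orbF //.
Qed.

(** If [a] is in the clique, injectivity of [v] excludes any other handle there, so only clique
    neighbours remain. If [a] is on a handle, only its predecessor remains. *)
Lemma parent_free b c : sub_adj (Q :\ q) a b -> sub_adj (Q :\ q) a c -> b != c ->
  sub_adj (Q :\ q) b c.
Proof.
move=> /and3P[ka kb ab] /and3P[_ kc ac] bc; rewrite /sub_adj kb kc /=.
case: a aq ka ab ac => [d|p] /= /andP[/eqP e1 /eqP e2] ka.
  have notq q' : q' \in Q :\ q -> ~~ ((d == v (tag q')) && (tagged q' == 0 :> nat)%N).
    rewrite !inE => /andP[q'q _]; apply: contraNN q'q => /andP[/eqP e3 /eqP e4].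
    apply/eqP/handle_vertex_eq; last by rewrite e4 e2.
    by apply: v_inj; rewrite -e3 e1.
  case: b c kb kc bc => [b|q1] [c|q2] //= k1 k2 bc ab ac.
  - by have := notq _ k2; rewrite ac.
  - by have := notq _ k1; rewrite ab.
  - by have := notq _ k1; rewrite ab.
have notq q' : q' \in Q :\ q -> tag p == tag q' ->
    ((tagged p).+1 == tagged q' :> nat) = false.
  rewrite !inE => /andP[q'q _] /eqP e3; apply: contraNF q'q => /eqP e4.
  by apply/eqP/handle_vertex_eq; rewrite -?e3 // -e4 e2.
case: b c kb kc bc => [b|q1] [c|q2] //= k1 k2 bc.
- move=> /andP[_ /eqP p0] /andP[t2 H]; move: H; rewrite notq //= p0.
  by rewrite eqn0Ngt.
- move=> /andP[t2 H] /andP[_ /eqP p0]; move: H; rewrite notq //= p0.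
  by rewrite eqn0Ngt.
move=> /andP[t1 H1] /andP[t2 H2]; move: H1 H2; rewrite !notq //= => /eqP H1 /eqP H2.
case/negP: bc; apply/eqP; congr inr; apply: handle_vertex_eq.
  by rewrite -(eqP t1) -(eqP t2).
by apply: succn_inj; rewrite H1 H2.
Qed.

End RemoveLeaf.

Hypothesis m_gt0 : (0 < m)%N.

(** Indexed by [nat] to fit the Koszul matrices; indices from [m] on fall back to vertex 0. *)
Definition clique_vertex (l : nat) : 'I_n := h (inl (insubd (Ordinal m_gt0) l)).

Lemma clique_vertex_inj i j : (i < j < m)%N -> clique_vertex i != clique_vertex j.
Proof.
move=> /andP[ij jm]; apply/eqP => /(can_inj hK)[] /(congr1 val).
by rewrite !val_insubd jm (ltn_trans ij jm) => e; rewrite e ltnn in ij.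
Qed.

Local Notation J e := (binomial_edge_ideal (K := K) e).
Local Notation xc := (fun l => 'X_(lshift n (clique_vertex l)) : {mpoly K[n + n]}).
Local Notation yc := (fun l => 'X_(rshift n (clique_vertex l)) : {mpoly K[n + n]}).

Lemma clique_minor_ideal p : minor_ideal xc yc m p <-> J (sub_lollipop set0) p.
Proof.
have [J0 JD JM] := bei_ideal K (sub_lollipop set0).
split.
  move: p; apply: minor_ideal_min => // i j /andP[ij jm].
  apply: (@bei_gen K _ _ (clique_vertex i) (clique_vertex j)).
    exact: sub_lollipop_sym.
  rewrite /sub_lollipop /clique_vertex !hK /sub_adj /=; apply: contraTneq ij.
  by move/(congr1 val); rewrite !val_insubd jm; case: ifP => [_ ->|_ <-]; rewrite ?ltnn.
move: p; apply: bei_ind => [|p q|c i j _].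
- exact: minor_ideal0.
- exact: minor_idealD.
rewrite /sub_lollipop; case gi: (g i) => [a|p]; last by rewrite /sub_adj /= inE.
case gj: (g j) => [b|p]; last by rewrite /sub_adj /= inE ?andbF.
move=> /and3P[_ _ /= ab].
have cv (x : 'I_m) y : g y = inl x -> y = clique_vertex x.
  by move=> gy; apply: (can_inj gK); rewrite hK gy valKd.
rewrite (cv _ _ gi) (cv _ _ gj); apply: minor_idealM.
case: (ltngtP a b) => [lt_ab|lt_ba|/val_inj e]; last by rewrite e eqxx in ab.
  by apply: (@minor_ideal_gen _ xc yc); rewrite lt_ab ltn_ord.
rewrite edge_binomialC -mulN1r; apply: minor_idealM.
by apply: (@minor_ideal_gen _ xc yc); rewrite lt_ba ltn_ord.
Qed.

Lemma sub_lollipop_resolution Q : down_closed Q -> exists F,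
  minimal_graded_free_resolution (J (sub_lollipop Q)) F /\
  forall i j, nb_gens F i j = lollipop_betti m #|Q| i j.
Proof.
have [s] := ubnP #|Q|; elim: s Q => // s IHs Q; rewrite ltnS => Qs downQ.
have [->|/set0Pn[q0 q0Q]] := eqVneq Q set0.
  exists (en_complex K (fun l => lshift n (clique_vertex l))
                       (fun l => rshift n (clique_vertex l)) m); split.
    apply: resolution_iff clique_minor_ideal _; apply: en_resolution.
    - by move=> i j ijm; rewrite (inj_eq (@lshift_inj _ _)) clique_vertex_inj.
    - by move=> i j ijm; rewrite (inj_eq (@rshift_inj _ _)) clique_vertex_inj.
    - by move=> i j _ _; rewrite eq_lrshift.
  move=> [|i] j; rewrite nb_gens_en cards0 ?lollipop_betti_i0 //.
  by rewrite lollipop_betti_t0.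
(* A vertex farthest along its handle is a leaf, and removing it keeps [Q] down-closed. *)
case: (arg_maxnP (fun q : handle_vertex => tagged q : nat) q0Q) => q qQ qmax.
change (is_true (q \in Q)) in qQ.
have [a aq] := parent_ex q.
have downQ' : down_closed (Q :\ q).
  move=> p p'; rewrite !inE => /andP[p'q p'Q] tp lt_p; rewrite (downQ p p') // andbT.
  by apply: contraTneq lt_p => ->; rewrite -leqNgt; apply: qmax.
have [|//|F [resF nbF]] := IHs (Q :\ q).
  by apply: leq_trans Qs; rewrite [X in (_ < X)%N](cardsD1 q) qQ.
have ihE i b : (i == h b) = (g i == b) by rewrite -(inj_eq (can_inj gK)) hK.
have removeE i j : sub_lollipop Q i j = [|| sub_lollipop (Q :\ q) i j,
    (i == h a) && (j == h (inr q)) | (i == h (inr q)) && (j == h a)].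
  by rewrite !ihE; apply: sub_adj_remove.
exists (cone (edge_binomial K (h a) (h (inr q))) 2 F); split.
  apply: (@cone_resolution _ _ _ _ _ (J (sub_lollipop (Q :\ q)))) => //.
  - exact: bei_ideal.
  - exact: edge_binomial_homog.
  - move=> p; apply: edge_binomial_regular.
    + exact: sub_lollipop_sym.
    + exact: sub_lollipop_irr.
    + apply/free_vertexP => i j; rewrite /sub_lollipop hK => ai aj ij.
      by apply: (parent_free aq ai aj); rewrite (inj_eq (can_inj gK)).
    + by rewrite (inj_eq (can_inj hK)); apply: parent_neq aq.
    + by move=> i; rewrite /sub_lollipop hK /sub_adj /= !inE eqxx.
  - by apply: bei_add_edge removeE; apply: sub_lollipop_sym.
have -> : #|Q| = #|Q :\ q|.+1 by rewrite (cardsD1 q) qQ.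
move=> [|i] j; first by rewrite nb_gens_cone0 nbF !lollipop_betti_i0.
by rewrite nb_gens_coneS !nbF lollipop_bettiS.
Qed.

End Lollipop.

(** * Support of the Betti table and its strands *)

Lemma lollipop_betti_gt0 m t i j : (0 < lollipop_betti m t i j)%N ->
  (j == i.*2) && (i <= t)%N ||
  [&& i < j, j <= i.*2, i.*2.+2 - j <= m & j - i.+1 <= t]%N.
Proof.
rewrite /lollipop_betti addn_gt0 !muln_gt0 !lt0b !bin_gt0.
by move=> /orP[->//|/and3P[/andP[-> ->] /andP[_ ->] ->]]; rewrite orbT.
Qed.

Lemma lollipop_betti_strand m t i j : (0 < j < i)%N ->
  lollipop_betti m t i (i + j) = ((i - j + 1) * 'C(m, i - j + 2) * 'C(t, j - 1))%N.
Proof.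
move=> /andP[j0 ji]; rewrite /lollipop_betti -addnn eqn_add2l (ltn_eqF ji) add0n.
rewrite -{1}[i]addn0 ltn_add2l j0 leq_add2l (ltnW ji) mul1n.
by congr (_ * 'C(_, _) * 'C(_, _))%N; lia.
Qed.

Lemma lollipop_betti_diag m t i : (0 < i)%N ->
  lollipop_betti m t i (i + i) = ('C(t, i - 1) * 'C(m, 2) + 'C(t, i))%N.
Proof.
move=> i0; rewrite /lollipop_betti -addnn eqxx leqnn mul1n addnC.
rewrite -{1}[i]addn0 ltn_add2l i0 mul1n subSnn mul1n mulnC.
by congr ('C(_, _) * 'C(_, _) + _)%N; lia.
Qed.

Local Close Scope ring_scope.
Unset Implicit Arguments.

Theorem proposition3p8 (K : fieldType) (m k : nat) (ts : 'I_k -> nat) (n : nat)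
    (e : rel 'I_n) (hm : 2 <= m) (hk : 1 <= k <= m)
    (hts : forall i, 1 <= ts i) (hG : is_lollipop m ts e) :
  let t := \sum_(i < k) ts i in
  let J := binomial_edge_ideal (K := K) e in
  [/\ forall i j, 1 <= i -> 1 <= j <= i - 1 ->
        betti J i (i + j) =
          (i - j + 1) * 'C(m, i - j + 2) * 'C(t, j - 1),
      forall i, 1 <= i ->
        betti J i (i + i) = 'C(t, i - 1) * 'C(m, 2) + 'C(t, i),
      is_pd J (m + t - 1)
    & is_reg J (t + 1)].
Proof.
move=> t J; have [v [h [v_inj [g hK gK] eE]]] := hG.
have [|F [resF nbF]] := sub_lollipop_resolution K v_inj hK gK (ltnW hm) (Q := setT).
  by move=> q q' _ _ _; rewrite inE.
have cardT : #|[set: {i : 'I_k & 'I_(ts i)}]| = t.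
  rewrite cardsT card_tagged sumnE big_map big_enum /=.
  by apply: eq_bigr => i _; rewrite card_ord.
have bE i j : betti J i j = lollipop_betti m t i j.
  rewrite -cardT -nbF; apply: betti_eq; [exact: bei_ideal|exact: bei_graded|].
  have eqe i' j' : sub_lollipop v g setT i' j' = e i' j'.
    rewrite -[i' in RHS]gK -[j' in RHS]gK eE /sub_lollipop /sub_adj.
    by case: (g i') (g j') => [?|?] [?|?]; rewrite /= ?inE.
  have se : ssrbool.symmetric e by move=> i' j'; rewrite -!eqe sub_lollipop_sym.
  apply: resolution_iff resF => p; split.
    by apply: bei_sub => // i' j'; rewrite eqe.
  by apply: bei_sub => [|i' j']; [exact: sub_lollipop_sym|rewrite eqe].
split.
- move=> i j i0 /andP[j0 ji]; rewrite bE lollipop_betti_strand //; lia.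
- by move=> i i0; rewrite bE lollipop_betti_diag.
- split.
    (* The internal degree [m + 2t] comes from the top term s^(m-1) z^m of the clique times s^t
       z^(2t) from the handles. *)
    exists (m + t - 1 + t + 1); rewrite bE /lollipop_betti; apply/eqP.
    by rewrite -lt0n addn_gt0 !muln_gt0 !bin_gt0 lt0b -muln2; lia.
  (* Off the handle term, adding the bounds [i.*2.+2 - j <= m] and [j - i.+1 <= t] gives
     [i + 1 <= m + t]. *)
  move=> i j; rewrite bE => /eqP; rewrite -lt0n => /lollipop_betti_gt0.
  rewrite -muln2; lia.
split.
  (* On the diagonal at [i = t + 1] the summand ['C(t, t) * 'C(m, 2)] is positive since [m >= 2]. *)
  exists (t + 1); rewrite bE lollipop_betti_diag ?addn1 // subn1 /= binn mul1n.
  by apply/eqP; rewrite -lt0n addn_gt0 bin_gt0 hm.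
move=> i j; rewrite bE => /eqP; rewrite -lt0n => /lollipop_betti_gt0.
rewrite -muln2; lia.
Qed.
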